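(* Let $N\ge 1$ and let $s\in\mathbb{N}$, $s\geq 1$. (a) If $s$ is even, then for every choice of numbers $M_\beta\in\mathbb{R}_+$, indexed by multi-indices $\beta\in\mathbb{N}_0^N$ with $|\beta|\le s$, the space of all probability measures $\mu$ on $\mathbb{R}^N$ for which $\int_{\mathbb{R}^N}v^\beta\,d\mu(v)=M_\beta$ for all $|\beta|\le s$, endowed with the metric $d_s$, is complete. (b) If $s$ is odd, then there exist numbers $M_\beta\in\mathbb{R}_+$ for all multi-indices $\beta\in\mathbb{N}_0^N$ with $|\beta|\le s$ such that the space of all probability measures $\mu$ on $\mathbb{R}^N$ for which $\int_{\mathbb{R}^N}v^\beta\,d\mu(v)=M_\beta$ for all $|\beta|\le s$, endowed with the metric $d_s$, is not complete.
   Context: A probability measure on $\mathbb{R}^N$ is a (Radon) probability measure on the Borel $\sigma$-algebra. For a multi-index $\beta=(\beta_1,\dots,\beta_N)\in\mathbb{N}_0^N$ put $|\beta|=\beta_1+\dots+\beta_N$ and $v^\beta=v_1^{\beta_1}\cdots v_N^{\beta_N}$. The quantity $\int_{\mathbb{R}^N}v^\beta\,d\mu(v)$ is the moment of $\mu$ of order $\beta$; saying that it equals $M_\beta$ includes the requirement that the moment exists and is finite, i.e. that $v^\beta$ is $\mu$-integrable. $\mathbb{R}_+=[0,\infty)$. The Fourier transform (characteristic function) of $\mu$ is $\hat\mu(x)=\int_{\mathbb{R}^N}e^{-i\langle x,v\rangle}\,d\mu(v)$, $x\in\mathbb{R}^N$. For probability measures $\mu,\nu$ on $\mathbb{R}^N$,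 $$d_s(\mu,\nu)=\sup_{x\in\mathbb{R}^N\setminus\{0\}}\frac{|\hat\mu(x)-\hat\nu(x)|}{|x|^s},$$ where $|x|$ is the Euclidean norm. This is finite, and hence a metric, on the spaces of measures with equal finite moments up to order $s$ considered here. *)

(* Defs.v *)
From HB Require Import structures.
From mathcomp Require Import all_boot all_order all_algebra.
From mathcomp Require Import all_classical all_reals all_analysis.
From mathcomp Require Import complex.

Set Implicit Arguments.
Unset Strict Implicit.
Unset Printing Implicit Defensive.

Import Order.TTheory GRing.Theory Num.Theory.
Import numFieldNormedType.Exports.
Import Normc.

Local Open Scope classical_set_scope.
Local Open Scope ring_scope.

(* R^N with its Borel sigma-algebra.  The norm topology that the library puts
   on 'rV[R]_N comes from the sup norm, hence has the usual open sets. *)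
Definition borel_rV (R : realType) (N : nat) :
    measurableType (@open 'rV[R]_N).-sigma :=
  g_sigma_algebraType (@open 'rV[R]_N).

Section euclidean.
Context {R : realType} {N : nat}.
Implicit Types x v : 'rV[R]_N.

Definition dotp x v : R := \sum_(i < N) x 0 i * v 0 i.

(* The library's norm `|x| on 'rV[R]_N is the sup norm, not this one. *)
Definition enorm x : R := Num.sqrt (\sum_(i < N) x 0 i ^+ 2).

Definition mideg (b : {ffun 'I_N -> nat}) : nat := \sum_(i < N) b i.

Definition monomial (b : {ffun 'I_N -> nat}) v : R :=
  \prod_(i < N) v 0 i ^+ b i.

End euclidean.

Section fourier.
Context {R : realType} {N : nat}.
Implicit Types mu nu : probability (borel_rV R N) R.

Definition has_moment mu (b : {ffun 'I_N -> nat}) (m : R) : Prop :=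
  mu.-integrable [set: borel_rV R N] (fun v => (monomial b v)%:E) /\
  (\int[mu]_v (monomial b v)%:E)%E = m%:E.

(* The library only integrates real-valued functions, so the integral of
   exp(- i <x, v>) = cos <x, v> - i sin <x, v> is taken componentwise. *)
Definition fourier mu (x : 'rV[R]_N) : R[i] :=
  Complex (\int[mu]_v cos (dotp x v)) (- \int[mu]_v sin (dotp x v)).

(* normc is the complex modulus as an element of R; the supremum is taken in
   the extended reals, so no finiteness is presupposed. *)
Definition fdist (s : nat) mu nu : \bar R :=
  ereal_sup [set (normc (fourier mu x - fourier nu x) / enorm x ^+ s)%:E
            | x in [set x | x != 0]].

Lemma fdistxx s mu (e : R) : 0 < e -> (fdist s mu mu < e%:E)%E.
Proof.
move=> e0; apply: (@le_lt_trans _ _ 0%E); last by rewrite lte_fin.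
by apply: ge_ereal_sup => _ [x _ <-]; rewrite subrr normc0 mul0r.
Qed.

Lemma fdistC s mu nu : fdist s mu nu = fdist s nu mu.
Proof.
by congr ereal_sup; apply/seteqP; split=> _ [x x0 <-]; exists x => //;
  congr (_ / _)%:E; have := distrC (fourier mu x) (fourier nu x) => -[].
Qed.

Lemma fdist_triangle s mu nu xi :
  (fdist s mu xi <= fdist s mu nu + fdist s nu xi)%E.
Proof.
apply: ge_ereal_sup => _ [x x0 <-].
apply: (@le_trans _ _
  ((normc (fourier mu x - fourier nu x) / enorm x ^+ s)%:E +
   (normc (fourier nu x - fourier xi x) / enorm x ^+ s)%:E)%E); last first.
  by apply: leeD; apply: ereal_sup_ubound; exists x.
rewrite -EFinD lee_fin -mulrDl ler_wpM2r ?invr_ge0 ?exprn_ge0 ?sqrtr_ge0//.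
rewrite -lecR rmorphD -[X in X <= _]/`|fourier mu x - fourier xi x|.
by rewrite (le_trans (ler_distD (fourier nu x) _ _)).
Qed.

End fourier.

(* Only the values M b with mideg b <= s matter. *)
Record moment_space (R : realType) (N s : nat)
    (M : {ffun 'I_N -> nat} -> R) : Type := MomentSpace {
  moment_prob :> probability (borel_rV R N) R ;
  moment_probP : forall b, (mideg b <= s)%N -> has_moment moment_prob b (M b)
}.

Section moment_space_metric.
Context (R : realType) (N s : nat) (M : {ffun 'I_N -> nat} -> R).
Local Notation T := (moment_space s M).

Definition fball (mu : T) (e : R) : set T :=
  [set nu | (fdist s mu nu < e%:E)%E].

Let fent : set_system (T * T) := entourage_ fball.

HB.instance Definition _ := gen_eqMixin T.
HB.instance Definition _ := gen_choiceMixin T.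
HB.instance Definition _ := hasNbhs.Build T (nbhs_ fent).

Let fnbhsE : nbhs = nbhs_ fent. Proof. by []. Qed.

Let fball_center (mu : T) (e : R) : 0 < e -> fball mu e mu.
Proof. exact: fdistxx. Qed.

Let fball_sym (mu nu : T) (e : R) : fball mu e nu -> fball nu e mu.
Proof. by rewrite /fball/= fdistC. Qed.

Let fball_triangle (mu nu xi : T) (e1 e2 : R) :
  fball mu e1 nu -> fball nu e2 xi -> fball mu (e1 + e2) xi.
Proof.
rewrite /fball/= => h1 h2; apply: (le_lt_trans (fdist_triangle s mu nu xi)).
by rewrite EFinD; apply: lteD.
Qed.

HB.instance Definition _ := @Nbhs_isPseudoMetric.Build R T fent fnbhsE fball
  fball_center fball_sym fball_triangle erefl.

End moment_space_metric.

(* The library's completeType is restricted to pointed types, whereas a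
   moment_space can be empty. *)
Definition seq_complete (T : uniformType) : Prop :=
  forall u : nat -> T, cauchy (u @ \oo) -> exists l : T, u @ \oo --> l.

(* Main.v *)
(* Even s.  The moments of order s bound the s-th absolute moments, so a Cauchy
   sequence mu_n is tight and has a limit point mu along an ultrafilter, whose
   Fourier transform is the pointwise limit of those of mu_n; moreover mu has
   finite moments of order s.  (The ultralimit of the mu_n is only finitely
   additive; its values on the cells cut out by the first k rational balls are
   realised by nested intervals of [0, 1[, and mu is the law of the limit of
   points chosen in these cells.)  Taylor expansion at 0 shows that, when two
   measures have finite s-th moments and Fourier transforms within e |x| ^ s of
   each other, their moments of order < s agree and those of order s differ by
   O(e); hence mu has the prescribed moments, and mu_n converges to it.
   Odd s = 2m + 1.  Start from a uniform law on a few symmetric points of an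
   axis, and for each k put a mass proportional to 2 ^ (- k s) / (k + 1) at
   +- 2 ^ k, corrected at the initial points so that no moment of order <= s
   changes.  The increments of the cosine transform are Taylor remainders of
   order s + 1, which are O(min(|y| ^ (s - 1), |y| ^ (s + 1))), so the partial
   sums are Cauchy for d_s.  A limit would have an s-th absolute moment bounding
   the harmonic series. *)

From HB Require Import structures.
Require Import Defs.
From mathcomp Require Import all_boot all_order all_algebra.
From mathcomp Require Import all_classical all_reals all_analysis.
From mathcomp Require Import measurable_realfun.
From mathcomp Require Import complex ring lra.

Set Implicit Arguments.
Unset Strict Implicit.
Unset Printing Implicit Defensive.

Import Order.TTheory GRing.Theory Num.Theory.
Import numFieldNormedType.Exports.

Local Open Scope classical_set_scope.
Local Open Scope ring_scope.

(** * Taylor remainders of cos and sin *)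

(** Parity enters through |v_j| ^ s. For even s this is the monomial v_j ^ s, so its integral is a
    prescribed moment, common to the whole sequence; for odd s its integral is not among the
    moments. Both halves rest on one cancellation: if two measures have equal moments of order at
    most k - 2, the expectations of the order k remainder differ in absolute value exactly as those
    of cos (k even) or sin (k odd), so d_s controls them. In the odd case the distances must tend to
    0 while the s-th absolute moments grow like the harmonic series. This is possible because a
    frequency y mostly sees the scale 2 ^ k close to 1 / |y|: after division by |y| ^ s the other
    scales contribute geometrically less, so the terms of index at least n cost O(1 / (n + 1))
    uniformly in y, not the sum of the 1 / (k + 1). Compensating the added masses by interpolation
    of even powers preserves the moments of even order up to s - 1, while those of odd order, s
    included, vanish by symmetry. *)

Section trig_remainder.
Context {R : realType}.
Implicit Types (k : nat) (y : R).

(* Up to sign, the remainder of order k of the Taylor expansion at 0 of cos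
   (k even) or sin (k odd); the sign is chosen so that each function is the
   derivative of the next one. *)
Fixpoint trem k y : R :=
  match k with
  | 0 => cos y
  | 1 => sin y
  | k'.+2 => y ^+ k' / k'`!%:R - trem k' y
  end.

Lemma tremS2 k y : trem k.+2 y = y ^+ k / k`!%:R - trem k y.
Proof. by []. Qed.

Lemma nat_ind2 (P : nat -> Prop) :
  P 0 -> P 1 -> (forall k, P k -> P k.+2) -> forall k, P k.
Proof.
move=> P0 P1 PS k; suff: P k /\ P k.+1 by case.
by elim: k => [//|k [? ?]]; split => //; exact: PS.
Qed.

Lemma is_derive_expr_fact k y :
  is_derive y 1 (fun x : R => x ^+ k.+1 / (k.+1)`!%:R) (y ^+ k / k`!%:R).
Proof.
rewrite (_ : (fun _ => _) = (k.+1)`!%:R^-1 \*: ((@id R) ^+ k.+1)); last first.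
  by apply/funext => x /=; rewrite mulrC exprfctE.
apply: (is_derive_eq (is_deriveZ _ (is_deriveX k.+1 (is_derive_id y 1)))).
rewrite /GRing.scale/= factS natrM invfM.
have : k.+1%:R != 0 :> R by rewrite pnatr_eq0.
have : k`!%:R != 0 :> R by rewrite pnatr_eq0 -lt0n fact_gt0.
by move=> ? ?; field; apply/andP.
Qed.

Lemma is_derive_trem k y : is_derive y 1 (trem k.+1) (trem k y).
Proof.
elim/nat_ind2: k => [| |k IH].
- exact: is_derive_sin.
- rewrite (_ : trem 2 = cst 1 - @cos R); last first.
    by apply/funext => x; rewrite tremS2 expr0 fact0 divr1.
  by apply: is_derive_eq; rewrite sub0r opprK.
- rewrite (_ : trem k.+3 = (fun x : R => x ^+ k.+1 / (k.+1)`!%:R) - trem k.+1)//.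
  by apply: is_deriveB; exact: is_derive_expr_fact.
Qed.

Lemma is_derive_continuous (f df : R -> R) :
  (forall x : R, is_derive x 1 f (df x)) -> continuous f.
Proof.
by move=> h x; apply/differentiable_continuous/derivable1_diffP; case: (h x).
Qed.

Lemma continuous_trem k : continuous (trem k).
Proof.
by case: k => [|k]; [exact: continuous_cos|exact: is_derive_continuous (is_derive_trem k)].
Qed.

Lemma trem0 k : (0 < k)%N -> trem k 0 = 0.
Proof.
elim/nat_ind2: k => [//| |[|k] IH] _; first exact: sin0.
  by rewrite tremS2 expr0 fact0 divr1 /= cos0 subrr.
by rewrite tremS2 IH// exprS !mul0r subrr.
Qed.

Lemma tremN k y : trem k (- y) = (-1) ^+ k * trem k y.
Proof.
elim/nat_ind2: k => [| |k IH]; rewrite ?tremS2.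
- by rewrite expr0 mul1r /= cosN.
- by rewrite expr1 mulN1r /= sinN.
- by rewrite IH [(- y) ^+ k]exprNn !exprS; ring.
Qed.

Lemma le_of_is_derive (f g df dg : R -> R) (y : R) :
  (forall x : R, is_derive x 1 f (df x)) -> (forall x : R, is_derive x 1 g (dg x)) ->
  f 0 = g 0 -> (forall x : R, 0 <= x -> df x <= dg x) -> 0 <= y -> f y <= g y.
Proof.
move=> hf hg fg0 dfg y0.
have hgf (x : R) : is_derive x 1 (g - f) (dg x - df x) by exact: is_deriveB.
have [c /[!in_itv]/= /andP[c0 _]] : exists2 c, c \in `[0, y]%R &
    (g - f) y - (g - f) 0 = (dg c - df c) * (y - 0).
  apply: (@MVT_segment R _ (fun x => dg x - df x)) => //.
  by apply: continuous_subspaceT; exact: is_derive_continuous hgf.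
rewrite !fctE fg0 subrr !subr0 => h.
by rewrite -subr_ge0 h mulr_ge0// subr_ge0 dfg.
Qed.

(** By parity only y >= 0 matters; there the two bounds of order k integrate to those of order k +
    1, since [trem k] is the derivative of [trem k.+1] and all terms vanish at 0. *)
Lemma norm_trem_le k y : `|trem k y| <= `|y| ^+ k / k`!%:R.
Proof.
wlog y0 : y / 0 <= y.
  move=> h; have [/h//|y0] := leP 0 y.
  by rewrite -(opprK y) tremN normrMsign normrN h// oppr_ge0 ltW.
rewrite (ger0_norm y0) ler_norml; elim: k y y0 => [|k IH] y y0.
  by rewrite expr0 fact0 divr1 /= cos_geN1 cos_le1.
have h0 : (0 : R) ^+ k.+1 / (k.+1)`!%:R = 0 by rewrite exprS !mul0r.
apply/andP; split.
  apply: (@le_of_is_derive (- (fun x : R => x ^+ k.+1 / (k.+1)`!%:R)) (trem k.+1)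
    (- (fun x : R => x ^+ k / k`!%:R)) (trem k)) => //.
  - move=> x; apply: is_deriveN; exact: is_derive_expr_fact.
  - exact: is_derive_trem.
  - by rewrite trem0// fctE h0 oppr0.
  - by move=> x /IH/andP[].
apply: (@le_of_is_derive (trem k.+1) (fun x : R => x ^+ k.+1 / (k.+1)`!%:R)
  (trem k) (fun x : R => x ^+ k / k`!%:R)) => //.
- exact: is_derive_trem.
- exact: is_derive_expr_fact.
- by rewrite trem0// h0.
- by move=> x /IH/andP[].
Qed.

(** The bound for large y: two powers fewer than in [norm_trem_le], which is the better one near
    0. *)
Lemma norm_tremS2_le k y : `|trem k.+2 y| <= 2 * (`|y| ^+ k / k`!%:R).
Proof.
rewrite tremS2 (le_trans (ler_normB _ _))// mulr_natl mulr2n lerD ?norm_trem_le//.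
by rewrite normrM normrX normfV normr_nat.
Qed.

Lemma tremS2_ge0 k y : 0 <= y -> 0 <= trem k.+2 y.
Proof.
elim: k y => [|k IH] y y0.
  by rewrite tremS2 expr0 fact0 divr1 subr_ge0 cos_le1.
apply: (@le_of_is_derive (cst 0) (trem k.+3) (cst 0) (trem k.+2)) => //.
- exact: is_derive_trem.
- by rewrite trem0.
Qed.

Lemma trem_even_ge0 k y : ~~ odd k -> 0 <= trem k.+2 y.
Proof.
move=> ek; have [/tremS2_ge0//|y0] := leP 0 y.
rewrite -(opprK y) tremN -signr_odd /= negbK (negbTE ek) mul1r tremS2_ge0//.
by rewrite oppr_ge0 ltW.
Qed.

(** At 1 the next remainder 1 / (k + 2)! - [trem k.+2 1] is at most 1 / (k + 4)!, which is less than
    1 / (k + 2)!. *)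
Lemma trem_gt0 k : 0 < trem k.+2 1.
Proof.
have := norm_trem_le k.+4 1; rewrite (ger0_norm (tremS2_ge0 _ ler01)) tremS2.
rewrite normr1 !expr1n !div1r lerBlDr -lerBlDl; apply: lt_le_trans.
rewrite subr_gt0 ltf_pV2 ?posrE ?ltr0n ?fact_gt0// ltr_nat.
by rewrite (factS k.+3) (factS k.+2) mulnA -[X in (X < _)%N]mul1n ltn_pmul2r ?fact_gt0.
Qed.

End trig_remainder.

(** * Limits of tight sequences of probability measures *)

Lemma uniform_prob_itv {R : realType} (a b : R) : 0 <= a -> a <= b -> b <= 1 ->
  uniform_prob (@ltr01 R) `[a, b[%classic = (b - a)%:E.
Proof.
move=> a0 ab b1; rewrite /uniform_prob integral_uniform_pdf.
rewrite setIidl; last first.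
  move=> u /=; rewrite !in_itv/= => /andP[au ub].
  by rewrite (le_trans a0 au) (le_trans (ltW ub) b1).
rewrite (eq_integral (cst 1%E)); last first.
  move=> u; rewrite inE/= in_itv/= => /andP[au ub]; rewrite /uniform_pdf.
  by rewrite (le_trans a0 au) (le_trans (ltW ub) b1)/= subr0 invr1.
rewrite integral_cst//= mul1e.
transitivity (@lebesgue_measure R `[a, b[%classic) => //.
rewrite lebesgue_measure_itv/= lte_fin -EFinB.
by case: ltP => // ba; congr EFin; lra.
Qed.

(** * Random binary words with prescribed laws *)

Section realization.
Context {R : realType}.
(* Words are read from right to left: [b :: w] extends the word w by the bit b.
   The words of length k cut [0, 1[ into consecutive intervals of lengths p w, so
   the word [unit_code u k] of the interval containing u has law p when u is
   uniform. *)
Variable p : seq bool -> R.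
Hypothesis p_ge0 : forall w, 0 <= p w.
Hypothesis p_nil : p [::] = 1.
Hypothesis p_split : forall w, p w = p (false :: w) + p (true :: w).

Fixpoint left_end (w : seq bool) : R :=
  if w is b :: w' then left_end w' + (if b then p (false :: w') else 0) else 0.

Fixpoint unit_code (u : R) (k : nat) : seq bool :=
  if k is k'.+1 then
    let w := unit_code u k' in (left_end w + p (false :: w) <= u) :: w
  else [::].

Lemma size_unit_code u k : size (unit_code u k) = k.
Proof. by elim: k => //= k ->. Qed.

Lemma unit_codeP (u : R) w : 0 <= u < 1 ->
  reflect (left_end w <= u < left_end w + p w) (unit_code u (size w) == w).
Proof.
move=> u01; apply: (iffP eqP) => [|].
  move: (size w) => k <-; elim: k => [|k /=]; first by rewrite /= add0r p_nil.
  move: (unit_code u k) => w'; rewrite p_split => /andP[h1 h2].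
  have [h|h] /= := leP (left_end w' + p (false :: w')) u.
    by rewrite h -addrA h2.
  by rewrite addr0 h1 h.
elim: w => [//|b w IH] /= /andP[h1 h2].
have pf := p_ge0 (false :: w); have pt := p_ge0 (true :: w).
rewrite IH; last first.
  by rewrite p_split; case: b h1 h2 => /= h1 h2; apply/andP; split; lra.
congr cons; case: b h1 h2 => /= h1 h2; first by rewrite h1.
by apply/negbTE; rewrite -ltNge; lra.
Qed.

Lemma left_end_ge0 w : 0 <= left_end w.
Proof. by elim: w => //= b w IH; rewrite addr_ge0//; case: b. Qed.

Lemma right_end_le1 w : left_end w + p w <= 1 :> R.
Proof.
elim: w => [|b w]; first by rewrite /= add0r p_nil.
apply: le_trans; rewrite (p_split w) /=.
by have := p_ge0 (false :: w); have := p_ge0 (true :: w); case: b => ? ?; lra.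
Qed.

(** The uniform law is a measure on all of R. Sending the null set outside [0, 1[ to 0 makes the
    weight of the code positive at every point and not merely almost surely. *)
Definition clip01 (u : R) : R := if 0 <= u < 1 then u else 0.

Lemma clip01_itv (u : R) : 0 <= clip01 u < 1.
Proof. by rewrite /clip01; case: ifPn => // _; rewrite lexx ltr01. Qed.

(** A half-open interval that contains a point has positive length. *)
Lemma unit_code_gt0 (u : R) k : 0 < p (unit_code (clip01 u) k).
Proof.
have := unit_codeP (unit_code (clip01 u) k) (clip01_itv u).
rewrite size_unit_code eqxx => /elimT/(_ isT)/andP[h1 h2].
by rewrite -(ltrD2l (left_end (unit_code (clip01 u) k))) addr0 (le_lt_trans h1).
Qed.

Let cell w := [set u : R | unit_code (clip01 u) (size w) = w].

Let cell_itv w : cell w `&` `[0, 1[%classic = `[left_end w, left_end w + p w[%classic.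
Proof.
apply/seteqP; split => u /=; rewrite !in_itv/=.
  by rewrite /cell/= /clip01 => -[+ u01]; rewrite u01 => /eqP/(unit_codeP w u01).
move=> h; have u01 : 0 <= u < 1.
  move/andP: h => [h1 h2]; apply/andP; split.
    exact: le_trans (left_end_ge0 w) h1.
  exact: lt_le_trans h2 (right_end_le1 w).
by split=> //; rewrite /cell/= /clip01 u01; apply/eqP/(unit_codeP w u01).
Qed.

Let measurable_cell w : measurable (cell w : set R).
Proof.
rewrite -(setUIDK (cell w) `[0, 1[%classic) cell_itv; apply: measurableU => //.
(* Every point outside [0, 1[ has the code of 0, so this part of the cell is either the whole
   complement or empty. *)
have [h|h] := pselect (unit_code 0 (size w) = w).
  rewrite (_ : _ `\` _ = ~` `[0, 1[%classic); first exact: measurableC.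
  apply/seteqP; split=> u /= => [[]//|]; rewrite in_itv/= => /negP/negbTE u01.
  by split; [rewrite /cell/= /clip01 u01|rewrite u01].
rewrite (_ : _ `\` _ = set0)// -subset0 => u [] /=.
by rewrite in_itv/= /cell/= /clip01; case: ifPn.
Qed.

Let prob_cell w : uniform_prob (@ltr01 R) (cell w) = (p w)%:E.
Proof.
have P1 : uniform_prob (@ltr01 R) `[0, 1[%classic = 1%E.
  by rewrite uniform_prob_itv// subr0.
have -> := measureDI (uniform_prob (@ltr01 R)) (measurable_cell w)
  (@measurable_itv R `[0, 1[).
have PI : uniform_prob (@ltr01 R) (cell w `&` `[0, 1[) = (p w)%:E.
  rewrite cell_itv [LHS]uniform_prob_itv ?left_end_ge0 ?lerDl ?right_end_le1//.
  by rewrite addrC addKr.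
rewrite [X in (_ + X)%E]PI.
rewrite [X in (X + _)%E](_ : _ = 0%E) ?add0e//; apply/eqP; rewrite eq_le measure_ge0 andbT.
apply: (@le_trans _ _ (uniform_prob (@ltr01 R) (~` `[0, 1[%classic))).
  apply: le_measure; rewrite ?inE; [|exact: measurableC|by move=> ? []].
  by apply: measurableD => //; exact: measurable_cell.
by rewrite probability_setC// [X in (_ - X)%E]P1 subee.
Qed.

(** A Kolmogorov extension theorem for binary words. Positivity of [p (W o k)] at every outcome
    later ensures that all cells met along [W o] are nonempty. *)
Lemma realization : exists (d : measure_display) (O : measurableType d)
    (P : probability O R) (W : O -> nat -> seq bool),
  [/\ forall o k, exists b, W o k.+1 = b :: W o k,
      forall o k, size (W o k) = k,
      forall o k, 0 < p (W o k),
      forall w, measurable [set o | W o (size w) = w] &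
      forall w, P [set o | W o (size w) = w] = (p w)%:E].
Proof.
exists _, _, (uniform_prob (@ltr01 R)), (fun u => unit_code (clip01 u)); split.
- by move=> u k /=; eexists.
- by move=> u k; rewrite size_unit_code.
- exact: unit_code_gt0.
- exact: measurable_cell.
- exact: prob_cell.
Qed.

End realization.

(** * Measurability and integration *)

Section borel_measurability.
Context {R : realType} {N : nat}.

Lemma open_measurable_borel (A : set 'rV[R]_N) :
  open A -> measurable (A : set (borel_rV R N)).
Proof. exact: sub_sigma_algebra. Qed.

Lemma continuous_measurable_borel (f : 'rV[R]_N -> R) :
  continuous f -> measurable_fun [set: borel_rV R N] f.
Proof.
move=> cf; apply: (measurability _ (RGenOpens.measurableE R)) => _ [_ [a [b ->]] <-].
rewrite setTI; apply: open_measurable_borel; apply: open_comp => // x _; exact: cf.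
Qed.

Lemma measurable_coord j : measurable_fun [set: borel_rV R N] (fun v => v 0 j).
Proof. by apply: continuous_measurable_borel; exact: coord_continuous. Qed.

Lemma measurable_tail (K : R) :
  measurable ([set v | exists j, K < `|v 0 j|] : set (borel_rV R N)).
Proof.
rewrite (_ : mkset _ = \bigcup_(j in [set: 'I_N]) [set v | K < `|v 0 j|]); last first.
  by apply/seteqP; split => v /= [j]; [exists j|exists j].
apply: fin_bigcup_measurable => [|j _]; first exact: finite_finset.
have mf : measurable_fun [set: borel_rV R N] (fun v => `|v 0 j|).
  by apply: measurableT_comp => //; exact: measurable_coord.
have := mf measurableT `]K, +oo[%classic (measurable_itv _).
by rewrite setTI; congr measurable; apply/seteqP; split=> v /=; rewrite in_itv/= andbT.
Qed.

End borel_measurability.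

Section probability_expectation.
Context d (T : measurableType d) (R : realType) (P : probability T R).
Implicit Types f g : T -> R.

Lemma bounded_integrable f (B : R) : measurable_fun setT f ->
  (forall x, `|f x| <= B) -> P.-integrable setT (EFin \o f).
Proof.
move=> mf fB; apply: measurable_bounded_integrable => //.
  by rewrite [X in (X < _)%E]probability_setT ltry.
exists B; split => [|x Bx y _] /=; first by rewrite num_real.
exact: le_trans (fB y) (ltW Bx).
Qed.

Lemma Rintegral_prob_cst (r : R) : \int[P]_x r = r.
Proof. by rewrite Rintegral_cst// [X in fine X]probability_setT mulr1. Qed.

Lemma Rintegral_indic (A : set T) : measurable A -> \int[P]_x \1_A x = fine (P A).
Proof. by move=> mA; rewrite /Rintegral integral_indic// setIT. Qed.

End probability_expectation.

Section real_integrable.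
Context d (T : measurableType d) (R : realType) (mu : {measure set T -> \bar R}).
Context (D : set T) (mD : measurable D).
Implicit Types f g : T -> R.

Lemma integrable_addr f g : mu.-integrable D (EFin \o f) ->
  mu.-integrable D (EFin \o g) -> mu.-integrable D (EFin \o (fun x => f x + g x)).
Proof. exact: integrableD. Qed.

Lemma integrable_subr f g : mu.-integrable D (EFin \o f) ->
  mu.-integrable D (EFin \o g) -> mu.-integrable D (EFin \o (fun x => f x - g x)).
Proof. exact: integrableB. Qed.

Lemma integrable_mulr (r : R) f : mu.-integrable D (EFin \o f) ->
  mu.-integrable D (EFin \o (fun x => r * f x)).
Proof. exact: integrableZl. Qed.

Lemma Rintegral_sum (I : Type) (r : seq I) (P : pred I) (f : I -> T -> R) :
  (forall i, mu.-integrable D (EFin \o f i)) ->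
  \int[mu]_(x in D) (\sum_(i <- r | P i) f i x) =
  \sum_(i <- r | P i) \int[mu]_(x in D) f i x.
Proof.
move=> fi; rewrite /Rintegral sum_fine; last by move=> i _; apply: integrable_fin_num => //; exact: fi.
rewrite -integral_sum//; congr (fine _).
by apply: eq_integral => x _; rewrite sumEFin.
Qed.

End real_integrable.

(** * Functions of a random word of fixed length *)

Section finite_code.
Context d (T : measurableType d) (R : realType) (P : probability T R).
Variables (W : T -> seq bool) (k : nat).
Hypothesis sizeW : forall x, size (W x) = k.
Hypothesis measurableW : forall w, size w = k -> measurable [set x | W x = w].

Lemma measurable_code_pred (S : set (seq bool)) : measurable [set x | S (W x)].
Proof.
rewrite (_ : [set _ | _] = \bigcup_(w in [set w : k.-tuple bool | S w]) [set x | W x = w]).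
  apply: fin_bigcup_measurable => [|w _]; first exact: finite_finset.
  by apply: measurableW; rewrite size_tuple.
apply/seteqP; split => x /=; last by move=> [w Sw ->].
by move=> SW; have /eqP Wk := sizeW x; exists (Tuple Wk).
Qed.

Lemma code_sumE (h : seq bool -> R) x :
  h (W x) = \sum_(w : k.-tuple bool) h w * \1_[set y | W y = w] x.
Proof.
have /eqP Wk := sizeW x.
rewrite (bigD1 (Tuple Wk))//= indicE mem_set//= mulr1 big1 ?addr0// => w wW.
rewrite indicE memNset ?mulr0//= => Wx; move/eqP : wW; apply.
by apply: val_inj; rewrite /= Wx.
Qed.

Let measurable_term (h : seq bool -> R) (w : k.-tuple bool) :
  measurable_fun setT (fun x => h w * \1_[set y | W y = w] x).
Proof.
apply: measurable_funM => //; apply: measurable_indic.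
by apply: measurableW; rewrite size_tuple.
Qed.

Let integrable_term (h : seq bool -> R) (w : k.-tuple bool) :
  P.-integrable setT (EFin \o (fun x => h w * \1_[set y | W y = w] x)).
Proof.
apply: (@bounded_integrable _ _ _ _ _ `|h w|) => [|x]; first exact: measurable_term.
by rewrite normrM ler_piMr// indicE; case: (_ \in _); rewrite ?normr1 ?normr0.
Qed.

Lemma integrable_code_fun (h : seq bool -> R) : P.-integrable setT (EFin \o (h \o W)).
Proof.
rewrite (_ : _ \o _ = fun x => \sum_(w : k.-tuple bool) (h w * \1_[set y | W y = w] x)%:E)%E.
  by apply: integrable_sum => // w _; exact: integrable_term.
by apply/funext => x /=; rewrite code_sumE sumEFin.
Qed.

Lemma expectation_code (h : seq bool -> R) :
  \int[P]_x h (W x) = \sum_(w : k.-tuple bool) h w * fine (P [set x | W x = w]).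
Proof.
under eq_Rintegral do rewrite code_sumE.
rewrite Rintegral_sum//.
apply: eq_bigr => w _; rewrite -Rintegral_indic; last first.
  by apply: measurableW; rewrite size_tuple.
rewrite -RintegralZl//; apply: (@bounded_integrable _ _ _ _ _ 1) => [|x].
  by apply: measurable_indic; apply: measurableW; rewrite size_tuple.
by rewrite indicE; case: (_ \in _); rewrite ?normr1 ?normr0.
Qed.

Lemma code_prob (S : set (seq bool)) :
  P [set x | S (W x)] = (\sum_(w : k.-tuple bool | `[< S w >]) fine (P [set x | W x = w]))%:E.
Proof.
rewrite -(@fineK _ (P [set x | S (W x)])); last first.
  by rewrite fin_num_measure//; exact: measurable_code_pred.
congr EFin; rewrite -Rintegral_indic; last exact: measurable_code_pred.
rewrite (_ : \1_[set x | S (W x)] = fun x => (\1_S (W x) : R))//.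
rewrite (expectation_code (\1_S)) [RHS]big_mkcond; apply: eq_bigr => w _.
rewrite indicE; case: asboolP => Sw; first by rewrite mem_set// mul1r.
by rewrite memNset// mul0r.
Qed.

(** Off Z and on words in S the error is at most e; elsewhere both functions are bounded by B.
    Applied to the measures of the sequence and to the limit alike, it leaves only finitely many
    cell probabilities to compare. *)
Lemma quantized_expectation (g : T -> R) (h : seq bool -> R) (B e : R)
    (Z : set T) (S : set (seq bool)) :
  measurable_fun setT g -> (forall x, `|g x| <= B) -> (forall w, `|h w| <= B) ->
  measurable Z -> P Z = 0%E -> 0 <= e ->
  (forall x, ~ Z x -> S (W x) -> `|g x - h (W x)| <= e) ->
  `|\int[P]_x g x - \sum_(w : k.-tuple bool) h w * fine (P [set x | W x = w])|
    <= e + 2 * B * fine (P [set x | ~ S (W x)]).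
Proof.
move=> mg gB hB mZ PZ e0 gh.
have B0 : 0 <= B by exact: le_trans (hB [::]).
have gi := bounded_integrable P mg gB.
have hi := integrable_code_fun h.
rewrite -expectation_code -RintegralB//.
have ghi : P.-integrable setT (EFin \o (fun x => g x - h (W x))).
  exact: integrable_subr hi.
apply: (le_trans (le_normr_Rintegral _ ghi)) => //.
have mS : measurable [set x | ~ S (W x)] := measurable_code_pred (~` S).
have ind A : measurable A -> P.-integrable setT (EFin \o (\1_A : T -> R)).
  move=> mA; apply: (@bounded_integrable _ _ _ _ _ 1) => [|x].
    exact: measurable_indic.
  by rewrite indicE; case: (_ \in _); rewrite ?normr1 ?normr0.
have Zi (A : set T) (r : R) : measurable A ->
    P.-integrable setT (EFin \o (fun x => r * \1_A x)).
  by move=> /ind iA; exact: integrable_mulr.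
have ci (r : R) : P.-integrable setT (EFin \o (fun x => r)).
  by apply: (@bounded_integrable _ _ _ _ _ `|r|) => //; exact: measurable_cst.
apply: (@le_trans _ _ (\int[P]_x (e + 2 * B * \1_[set x | ~ S (W x)] x + 2 * B * \1_Z x))).
  apply: le_Rintegral => //.
  - exact: integrable_norm ghi.
  - by do 2 (apply: integrable_addr; rewrite ?ci//; try exact: Zi).
  move=> x _; rewrite !indicE.
  have gh2 : `|g x - h (W x)| <= 2 * B.
    by rewrite (le_trans (ler_normB _ _))// mulr_natl mulr2n lerD.
  have [xZ|xZ] := pselect (Z x).
    by rewrite (mem_set xZ) mulr1 (le_trans gh2)// lerDr addr_ge0// !mulr_ge0.
  rewrite (memNset xZ) mulr0 addr0.
  have [xS|xS] := pselect (S (W x)).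
    by rewrite (le_trans (gh _ xZ xS))// lerDl !mulr_ge0.
  by rewrite mem_set// mulr1 (le_trans gh2)// lerDr.
rewrite RintegralD//; last 2 first.
- by apply: integrable_addr => //; exact: Zi.
- exact: Zi.
rewrite RintegralD//; last exact: Zi.
rewrite !RintegralZl//; [|exact: ind|exact: ind].
by rewrite !Rintegral_indic// PZ mulr0 addr0 Rintegral_prob_cst.
Qed.

End finite_code.

(** * Coding points by membership in rational balls *)

Section ball_code.
Context {R : realType} {N : nat}.
Implicit Types (v : 'rV[R]_N) (w : seq bool).

Definition rat_ball (i : nat) : set 'rV[R]_N :=
  if unpickle i is Some cn then
    let: (c, n) := cn : {ffun 'I_N -> rat} * nat in
    [set v | forall j, `|v 0 j - ratr (c j)| < n.+1%:R^-1]
  else set0.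

Lemma measurable_rat_ball i : measurable (rat_ball i : set (borel_rV R N)).
Proof.
rewrite /rat_ball; case: unpickle => [[c n]|]; last exact: measurable0.
rewrite (_ : mkset _ =
    \bigcap_(j in [set: 'I_N]) [set v | `|v 0 j - ratr (c j)| < n.+1%:R^-1]); last first.
  by apply/seteqP; split => v /= h j; [move=> _|]; exact: h.
apply: fin_bigcap_measurable => [|j _]; first exact: finite_finset.
have mf : measurable_fun [set: borel_rV R N] (fun v => `|v 0 j - ratr (c j)|).
  apply: measurableT_comp => //; apply: measurable_funB => //; exact: measurable_coord.
have := mf measurableT `]-oo, n.+1%:R^-1[%classic (measurable_itv _).
by rewrite setTI; congr measurable; apply/seteqP; split=> v /=; rewrite in_itv/=.
Qed.

(* The most recent bit comes first, as in [unit_code]. *)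
Fixpoint ball_code (k : nat) v : seq bool :=
  if k is k'.+1 then `[< rat_ball k' v >] :: ball_code k' v else [::].

Lemma size_ball_code k v : size (ball_code k v) = k.
Proof. by elim: k => //= k ->. Qed.

Lemma measurable_ball_code w :
  measurable ([set v | ball_code (size w) v = w] : set (borel_rV R N)).
Proof.
elim: w => [|b w IH] /=.
  by rewrite [X in measurable X](_ : _ = setT); [exact: measurableT|exact/seteqP].
rewrite (_ : mkset _ = [set v | ball_code (size w) v = w] `&`
    (if b then rat_ball (size w) else ~` rat_ball (size w))).
  apply: measurableI => //; case: b; last apply: measurableC; exact: measurable_rat_ball.
apply/seteqP; split => v /=.
  by move=> [<- ->]; split=> //; case: asboolP.
by case: b => -[-> h]; congr cons; [exact/asboolP|exact/asboolPn].
Qed.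

Lemma ball_code_rat_ball k v v' i : ball_code k v = ball_code k v' -> (i < k)%N ->
  rat_ball i v -> rat_ball i v'.
Proof.
elim: k => [//|k IH] /= [bk ck]; rewrite ltnS leq_eqVlt => /predU1P[->|/(IH ck)//].
by move/asboolP; rewrite bk => /asboolP.
Qed.

(** The cube of half-side K is covered by finitely many balls around the points of a rational grid.
    Once k exceeds their indices, the code of v records a small ball containing v, and this ball
    contains every v' with the same code. *)
Lemma ball_code_fine (K e : R) : 0 < e -> exists k, forall v v',
  (forall j, `|v 0 j| <= K) -> ball_code k v = ball_code k v' ->
  forall j, `|v 0 j - v' 0 j| <= e.
Proof.
move=> e0.
have [n ne] : exists n, 2 * n.+1%:R^-1 <= e.
  exists (Num.truncn (2 / e)).
  rewrite ler_pdivrMr ?ltr0n// -ler_pdivrMl// mulrC.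
  by apply: ltW; have := truncnS_gt (2 / e).
have [m Km] : exists m : nat, K <= m%:R.
  by exists (Num.truncn K).+1; rewrite ltW// truncnS_gt.
(* Grid of step 1 / (n + 1) on [- m, m], with 2 m (n + 1) + 1 points per coordinate; the grid point
   used for v rounds each coordinate down. *)
pose L := (2 * m * n.+1).+1.
pose c (f : {ffun 'I_N -> 'I_L}) : {ffun 'I_N -> rat} :=
  [ffun j => (f j)%:R / n.+1%:R - m%:R].
have [k kP] : exists k, forall f : {ffun 'I_N -> 'I_L}, (pickle (c f, n) < k)%N.
  exists (\max_(f : {ffun 'I_N -> 'I_L}) pickle (c f, n)).+1 => f.
  by rewrite ltnS (leq_bigmax f).
exists k => v v' vK vv' j.
have n0 : 0 < n.+1%:R :> R by rewrite ltr0n.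
have fL i : (Num.truncn ((v 0 i + m%:R) * n.+1%:R)%R < L)%N.
  have := vK i; rewrite ler_norml => /andP[v1 v2].
  rewrite ltnS truncn_le_nat; apply: (@lt_le_trans _ _ ((2 * m * n.+1)%:R + 1)).
    rewrite natrM; apply: (@le_lt_trans _ _ ((2 * m)%:R * n.+1%:R)); last by rewrite ltrDl.
    by rewrite ler_pM2r// natrM; lra.
  by rewrite natr1.
pose f := [ffun i => Ordinal (fL i)].
have vb : rat_ball (pickle (c f, n)) v.
  rewrite /rat_ball pickleK => i; rewrite /c !ffunE /= rmorphB rmorphM /= fmorphV !ratr_nat.
  set t := (v 0 i + m%:R) * n.+1%:R.
  have t0 : 0 <= t.
    apply: mulr_ge0; last exact: ltW.
    by have := vK i; rewrite ler_norml => /andP[v1 v2]; lra.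
  have /andP[t1 t2] := truncn_itv t0.
  rewrite (_ : v 0 i - _ = (t - (Num.truncn t)%:R) / n.+1%:R); last first.
    by rewrite /t; field; rewrite gt_eqF.
  rewrite normrM (@ger0_norm _ n.+1%:R^-1) ?invr_ge0 ?ltW//.
  rewrite ltr_pdivrMr// mulVf ?gt_eqF//.
  rewrite ger0_norm; first by rewrite ltrBlDl -natr1 in t2 *.
  by rewrite subr_ge0.
have v'b : rat_ball (pickle (c f, n)) v'.
  exact: ball_code_rat_ball vv' (kP f) vb.
move: vb v'b; rewrite /rat_ball pickleK => /(_ j) vb /(_ j) v'b.
rewrite (le_trans _ ne)// (le_trans (ler_distD (ratr (c f j)) _ _))//.
by rewrite mulr_natl mulr2n; apply: lerD; last rewrite distrC; exact: ltW.
Qed.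

Definition fine_word (e : R) w := forall v v',
  ball_code (size w) v = w -> ball_code (size w) v' = w ->
  forall j, `|v 0 j - v' 0 j| <= e.

Definition word_point w : 'rV[R]_N := xget 0 [set v | ball_code (size w) v = w].

Lemma ball_code_point w : [set v | ball_code (size w) v = w] !=set0 ->
  ball_code (size w) (word_point w) = w.
Proof. by move=> [v wv]; rewrite /word_point; case: xgetP => [//|/(_ v)]. Qed.

End ball_code.

(** By compactness of [a, b] the image ultrafilter has a cluster point, and an ultrafilter converges
    to each of its cluster points. *)
Lemma ultrafilter_cvg {R : realType} {I : Type} (U : set_system I) (x : I -> R) (a b : R) :
  UltraFilter U -> (forall i, a <= x i <= b) -> cvg (x @ U).
Proof.
move=> UU xab; have PU : ProperFilter (x @ U) by exact: fmap_proper_filter.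
have Uab : U (x @^-1` `[a, b]%classic).
  by apply: filterS filterT => i _ /=; rewrite in_itv/= xab.
have [l [_ clusterl]] := @segment_compact R a b _ PU Uab.
apply/cvg_ex; exists l => V nV; have [//|UV] := in_ultra_setVsetC (x @^-1` V) UU.
by have [y [Vy]] := clusterl (~` V) V UV nV.
Qed.

Lemma law_exists {R : realType} d d' (T : measurableType d) (T' : measurableType d')
    (P : probability T R) (X : T -> T') : measurable_fun setT X ->
  exists nu : probability T' R, forall (f : T' -> R) B, measurable_fun setT f ->
    (forall x, `|f x| <= B) -> \int[nu]_y f y = \int[P]_x f (X x).
Proof.
move=> mX; pose Y : {mfun T >-> T'} := HB.pack X (isMeasurableFun.Build _ _ _ _ X mX).
exists (distribution P Y) => f B mf fB; rewrite /Rintegral integral_distribution//.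
  exact/measurable_EFinP.
apply: (@bounded_integrable _ _ _ _ _ B) => //; exact: measurableT_comp.
Qed.

(** * The limit measure along an ultrafilter *)

Section tight_limit.
Context {R : realType} {N : nat}.
Variables (mu : nat -> probability (borel_rV R N) R) (U : set_system nat).
Hypothesis UU : UltraFilter U.
Hypothesis tight : forall e : R, 0 < e -> exists K : R, forall n,
  (mu n [set v | exists j, (K < `|v 0 j|)%R] <= e%:E)%E.

Let cell w : set (borel_rV R N) := [set v | ball_code (size w) v = w].
Let q n w : R := fine (mu n (cell w)).
Let p w : R := lim ((q ^~ w) @ U).

Let measurable_cell w : measurable (cell w).
Proof. exact: measurable_ball_code. Qed.

Let q_itv n w : 0 <= q n w <= 1.
Proof.
rewrite /q fine_ge0//= -lee_fin fineK ?fin_num_measure//; exact: probability_le1.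
Qed.

Let q_cvg w : q ^~ w @ U --> p w.
Proof. by apply: (ultrafilter_cvg UU) => n; exact: q_itv. Qed.

Let p_ge0 w : 0 <= p w.
Proof.
apply: limr_ge; first by apply/cvg_ex; exists (p w); exact: q_cvg.
by apply: nearW => n; case/andP: (q_itv n w).
Qed.

Let p_nil : p [::] = 1.
Proof.
apply/cvg_lim => //; rewrite (_ : q ^~ [::] = cst 1); first exact: cvg_cst.
apply/funext => n; rewrite /q (_ : cell [::] = setT) ?[X in fine X]probability_setT//.
exact/seteqP.
Qed.

Let p_split w : p w = p (false :: w) + p (true :: w).
Proof.
apply/cvg_lim => //.
rewrite (_ : q ^~ w = q ^~ (false :: w) \+ q ^~ (true :: w)); last first.
  apply/funext => n /=; rewrite /q -fineD ?fin_num_measure// -measureU//.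
    congr (fine (mu n _)); apply/seteqP; split => v /=.
      by rewrite /cell /= => ->; case: asboolP; [right|left].
    by case=> -[].
  by rewrite -subset0 => v [[b0 _] [b1 _]]; rewrite b0 in b1.
by apply: cvgD; exact: q_cvg.
Qed.

Let p_gt0_cell w : 0 < p w -> cell w !=set0.
Proof.
move=> pw; apply/set0P/eqP => cell0; move: pw; rewrite (_ : p w = 0) ?ltxx//.
apply/cvg_lim => //; rewrite (_ : q ^~ w = cst 0); first exact: cvg_cst.
by apply/funext => n; rewrite /q cell0 measure0.
Qed.

(** Every point u of the cube given by tightness has a fine word once k is large, so blurred words
    only carry mass from outside the cube, uniformly in n. Two points of a cell are compared through
    u, whence e / 2. *)
Let blurred_small (e r : R) : 0 < e -> 0 < r -> exists k, forall n,
  (mu n [set v | ~ @fine_word R N e (ball_code k v)] <= r%:E)%E.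
Proof.
move=> e0 /tight[K muK]; have [k fk] := @ball_code_fine R N K (e / 2) ltac:(by rewrite divr_gt0).
exists k => n; apply: le_trans (muK n); apply: le_measure; rewrite ?inE.
- apply: (@measurable_code_pred _ (borel_rV R N) (ball_code k) k
      (size_ball_code k) _ (~` @fine_word R N e)) => w <-.
  exact: measurable_ball_code.
- exact: measurable_tail.
- move=> u /= nfu; apply: contrapT => nK; apply: nfu => v v'.
  rewrite size_ball_code => vu v'u j.
  have uK i : `|u 0 i| <= K by rewrite leNgt; apply/negP => Ku; apply: nK; exists i.
  rewrite (splitr e) (le_trans (ler_distD (u 0 j) _ _))// lerD//.
    by rewrite distrC; apply: fk.
  exact: fk.
Qed.

Let cvg_sum_q k (S : pred (seq bool)) (h : seq bool -> R) :
  (fun n => \sum_(w : k.-tuple bool | S w) h w * q n w) @ U -->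
  \sum_(w : k.-tuple bool | S w) h w * p w.
Proof.
apply: cvg_big => [|w _]; first exact: add_continuous.
by apply: cvgM; [exact: cvg_cst|exact: q_cvg].
Qed.

Section realized.
Context d (O : measurableType d) (P : probability O R) (W : O -> nat -> seq bool).
Hypothesis WS : forall o k, exists b, W o k.+1 = b :: W o k.
Hypothesis sizeW : forall o k, size (W o k) = k.
Hypothesis pW : forall o k, 0 < p (W o k).
Hypothesis mW : forall w, measurable [set o | W o (size w) = w].
Hypothesis PW : forall w, P [set o | W o (size w) = w] = (p w)%:E.

Let Y k o := word_point (W o k) : 'rV[R]_N.

Let ball_code_W k k' (v : 'rV[R]_N) o : (k <= k')%N -> ball_code k' v = W o k' -> ball_code k v = W o k.
Proof.
move=> /subnK <-; elim: (k' - k)%N => [//|i IH]; rewrite addSn /=.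
by have [b ->] := WS o (i + k) => -[_ /IH].
Qed.

Let ball_code_Y k o : ball_code k (Y k o) = W o k.
Proof.
have := @ball_code_point R N (W o k); rewrite sizeW; apply.
by have := p_gt0_cell (pW o k); rewrite /cell sizeW.
Qed.

Let Y_near e k k' o : @fine_word R N e (W o k) -> (k <= k')%N ->
  forall j, `|Y k o 0 j - Y k' o 0 j| <= e.
Proof.
move=> fw kk'; apply: fw; rewrite sizeW ?ball_code_Y//.
exact: ball_code_W (ball_code_Y k' o).
Qed.

(* The outcomes whose cells shrink to a point. *)
Let resolved : set O :=
  [set o | forall m, exists k, @fine_word R N m.+1%:R^-1 (W o k)].


(** The default 0 is taken on the unresolved outcomes, which form a null set by
    [unresolved_null]. *)
Let X o : 'rV[R]_N :=
  if pselect (resolved o) then \row_j lim ((fun k => Y k o 0 j) @ \oo) else 0.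

Let X_near e k o : resolved o -> @fine_word R N e (W o k) ->
  forall j, `|X o 0 j - Y k o 0 j| <= e.
Proof.
move=> ro fw j; rewrite /X; case: pselect => //= _; rewrite mxE.
have cY : cvg ((fun k => Y k o 0 j) @ \oo).
  apply: cauchy_cvg; apply: cauchy_exP => r r0.
  have [m mr] : exists m, m.+1%:R^-1 < r.
    exists (Num.truncn r^-1).
    by rewrite invf_plt ?posrE ?ltr0n// truncnS_gt.
  have [k0 fk0] := ro m; exists (Y k0 o 0 j); exists k0 => // k1 /= k01.
  by rewrite /ball/=; exact: le_lt_trans (Y_near fk0 k01 j) mr.
have cYk : (fun k' => `|Y k' o 0 j - Y k o 0 j|) @ \oo -->
    `|lim ((fun k => Y k o 0 j) @ \oo) - Y k o 0 j|.
  by apply: cvg_norm; apply: cvgB => //; exact: cvg_cst.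
apply: (cvgr_to_le cYk); near=> k1; rewrite distrC; apply: (Y_near fw).
by near: k1; exact: nbhs_infty_ge.
Unshelve. all: by end_near. Qed.

Let mWk k w : size w = k -> measurable [set o | W o k = w].
Proof. by move=> <-; exact: mW. Qed.

Let measurable_W k (S : set (seq bool)) : measurable [set o | S (W o k)].
Proof. by apply: (measurable_code_pred (k := k)) => //; exact: mWk. Qed.

Let measurable_resolved : measurable resolved.
Proof.
rewrite (_ : resolved = \bigcap_m \bigcup_k
    [set o | @fine_word R N m.+1%:R^-1 (W o k)]).
  by apply: bigcapT_measurable => m; apply: bigcupT_measurable => k; exact: measurable_W.
apply/seteqP; split => [x rx m _|x rx m]; first by have [k ?] := rx m; exists k.
by have [k _ ?] := rx m I; exists k.
Qed.

Let measurable_X : measurable_fun setT (X : O -> borel_rV R N).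
Proof.
apply: (@measurability _ _ _ (borel_rV R N) setT X (@open 'rV[R]_N) erefl) => _ [A oA <-]; rewrite setTI.
(* Words of small cells such that a whole box around the chosen point lies in A. A resolved outcome
   has X in A exactly when one of its words is of this kind, which is a countable union of events on
   finite words. *)
pose S (m : nat) := [set w | @fine_word R N m.+1%:R^-1 w /\
  forall v : 'rV[R]_N, (forall j, `|v 0 j - (word_point w : 'rV[R]_N) 0 j| <= m.+1%:R^-1) -> A v].
rewrite (_ : X @^-1` A =
   (resolved `&` \bigcup_m \bigcup_k [set o | S m (W o k)]) `|`
   (~` resolved `&` [set o | A 0])).
  apply: measurableU; apply: measurableI => //.
  - by apply: bigcupT_measurable => m; apply: bigcupT_measurable => k; exact: measurable_W.
  - exact: measurableC.
  - have [A0|A0] := pselect (A 0).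
      by rewrite (_ : mkset _ = setT)//; apply/seteqP; split.
    by rewrite (_ : mkset _ = set0)//; apply/seteqP; split.
apply/seteqP; split => o /=; last first.
  move=> [[ro [m _ [k _ [fw SA]]]]|[nro A0]]; last by rewrite /X; case: pselect.
  by apply: SA => j; exact: X_near.
have [ro AX|nro] := pselect (resolved o); last first.
  by rewrite {1}/X; case: pselect => //= _ A0; right.
left; split => //.
have [/= r r0 rA] : exists2 r : R, 0 < r & ball (X o) r `<=` A.
  by have /nbhs_ballP[r /= ? ?] := open_nbhs_nbhs (conj oA AX); exists r.
have [m mr] : exists m, 2 * m.+1%:R^-1 < r.
  exists (Num.truncn (2 / r)).
  by rewrite ltr_pdivrMr ?ltr0n// -ltr_pdivrMl// mulrC truncnS_gt.
have [k fk] := ro m; exists m => //; exists k => //; split => [//|v vY].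
apply: rA; split=> // i j; rewrite (ord1 i).
rewrite /ball/= (le_lt_trans (ler_distD (Y k o 0 j) _ _))// (le_lt_trans _ mr)//.
rewrite mulr_natl mulr2n lerD//; first exact: X_near.
by rewrite distrC.
Qed.

(** The bound common to all [mu n] passes to P, because P of the event is a finite sum of limits of
    cell probabilities. *)
Let blurred_W (e r : R) : 0 < e -> 0 < r -> exists k,
  (P [set o | ~ @fine_word R N e (W o k)] <= r%:E)%E /\
  forall n, (mu n [set v | ~ @fine_word R N e (ball_code k v)] <= r%:E)%E.
Proof.
move=> e0 r0; have [k muk] := blurred_small e0 r0; exists k; split => //.
rewrite (@code_prob _ _ _ _ (W ^~ k) k _ _ (~` @fine_word R N e)) => [|o|w]; last 2 first.
- exact: sizeW.
- exact: mWk.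
rewrite lee_fin.
under eq_bigr => w _.
  have -> : [set o | W o k = w] = [set o | W o (size w) = w] by rewrite size_tuple.
  rewrite PW /= -[p _]mul1r; over.
apply: (cvgr_to_le (@cvg_sum_q k (fun w => `[< (~` @fine_word R N e) w >]) (cst 1))).
apply: nearW => n; have := muk n.
rewrite (@code_prob _ (borel_rV R N) _ (mu n) (ball_code k) k _ _ (~` @fine_word R N e)) => [|v|w]; last 2 first.
- exact: size_ball_code.
- by move=> <-; exact: measurable_ball_code.
rewrite lee_fin; apply: le_trans; rewrite le_eqVlt; apply/orP; left; apply/eqP.
by apply: eq_bigr => w _; rewrite mul1r /q /cell size_tuple.
Qed.

(** Unresolved at scale 1 / (m + 1) means blurred at every level k, and a single suitable level
    already has arbitrarily small probability. *)
Let unresolved_null : P (~` resolved) = 0%E.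
Proof.
apply: measure_negligible; first exact: measurableC.
rewrite (_ : ~` resolved = \bigcup_m \bigcap_k
    [set o | ~ @fine_word R N m.+1%:R^-1 (W o k)]); last first.
  apply/seteqP; split => [x /existsNP[m /forallNP xm]|x [m _ xm] /(_ m)[k]].
    by exists m => // k _; exact: xm.
  exact: xm.
apply: negligible_bigcup => m.
have mB : measurable (\bigcap_k [set o | ~ @fine_word R N m.+1%:R^-1 (W o k)]).
  by apply: bigcapT_measurable => k; exact: (measurable_W k (~` _)).
apply/negligibleP => //; apply/eqP; rewrite eq_le measure_ge0 andbT.
apply/lee_addgt0Pr => r r0; rewrite add0e.
have m0 : 0 < m.+1%:R^-1 :> R by rewrite invr_gt0 ltr0n.
have [k [Pk _]] := blurred_W m0 r0.
by apply: le_trans Pk; apply: le_measure; rewrite ?inE//; [exact: (measurable_W k (~` _))|exact: bigcap_inf].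
Qed.


Let mbk k w : size w = k -> measurable ([set v | ball_code k v = w] : set (borel_rV R N)).
Proof. by move=> <-; exact: measurable_ball_code. Qed.

(** All comparisons are made at one level k: f against its cell values under P and under [mu n], at
    cost e / 8 + e / 4 each, and the cell probabilities against their limits, at cost e / 8. *)
Let cvg_expectation (f : 'rV[R]_N -> R) (B : R) :
  measurable_fun [set: borel_rV R N] f -> (forall v, `|f v| <= B) ->
  (forall e : R, 0 < e -> exists2 r : R, 0 < r &
     forall v w : 'rV[R]_N, (forall j, `|v 0 j - w 0 j| <= r) -> `|f v - f w| <= e) ->
  (fun n => \int[mu n]_v f v) @ U --> \int[P]_o f (X o).
Proof.
move=> mf fB uf; apply/cvgrPdist_le => e e0.
have B0 : 0 <= B by exact: le_trans (fB 0).
have e80 : 0 < e / 8 by rewrite divr_gt0.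
have [r r0 fr] := uf _ e80.
(* Blurred words cost at most 2 B times this mass, hence at most e / 4; B + 1 keeps the denominator
   positive. *)
have d0 : 0 < e / (8 * (B + 1)) by rewrite divr_gt0// mulr_gt0// ltr_wpDl.
have [k [Pk muk]] := blurred_W r0 d0.
have Bd : 2 * B * (e / (8 * (B + 1))) <= e / 4.
  rewrite [leLHS](_ : _ = e / 4 * (B / (B + 1))); last by field; rewrite gt_eqF// ltr_wpDl.
  by rewrite ler_piMr// ?divr_ge0 ?ltW// ltr_pdivrMr ?ltr_wpDl// mul1r ltrDl.
pose h w := f (word_point w).
have hq : (fun n => \sum_(w : k.-tuple bool) h w * q n w) @ U -->
   \sum_(w : k.-tuple bool) h w * p w by exact: (@cvg_sum_q k xpredT h).
have fP : `|\int[P]_o f (X o) - \sum_(w : k.-tuple bool) h w * p w| <= e / 8 + e / 4.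
  rewrite (eq_bigr (fun w : k.-tuple bool => h w * fine (P [set o | W o k = w]))); last first.
    move=> w _; congr (_ * _); have -> : [set o | W o k = w] = [set o | W o (size w) = w].
      by rewrite size_tuple.
    by rewrite PW.
  have Xf o : ~ (~` resolved) o -> @fine_word R N r (W o k) -> `|f (X o) - h (W o k)| <= e / 8.
    by move=> /contrapT ro fo; apply: fr => j; exact: X_near.
  have mfX : measurable_fun setT (fun o => f (X o)) := measurableT_comp mf measurable_X.
  apply: le_trans (@quantized_expectation _ O R P (W ^~ k) k (sizeW ^~ k) (mWk (k := k))
    _ h B _ _ _ mfX (fun o => fB _) (fun w => fB _) (measurableC measurable_resolved)
    unresolved_null (ltW e80) Xf) _.
  rewrite lerD2l (le_trans _ Bd)// ler_wpM2l ?mulr_ge0// -lee_fin fineK//.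
  by rewrite fin_num_measure//; exact: (measurable_W k (~` _)).
have fmu n : `|\int[mu n]_v f v - \sum_(w : k.-tuple bool) h w * q n w| <= e / 8 + e / 4.
  rewrite (eq_bigr (fun w : k.-tuple bool => h w * fine (mu n [set v | ball_code k v = w]))); last first.
    by move=> w _; rewrite /q /cell size_tuple.
  have vf v : ~ set0 v -> @fine_word R N r (ball_code k v) -> `|f v - h (ball_code k v)| <= e / 8.
    move=> _ fv; apply: fr => j; apply: fv; rewrite size_ball_code//.
    by have := @ball_code_point R N (ball_code k v); rewrite size_ball_code; apply; exists v.
  apply: le_trans (@quantized_expectation _ (borel_rV R N) R (mu n) (ball_code k) k
    (size_ball_code k) (@mbk k)
    _ h B _ _ _ mf fB (fun w => fB _) measurable0 (measure0 _) (ltW e80) vf) _.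
  rewrite lerD2l (le_trans _ Bd)// ler_wpM2l ?mulr_ge0// -lee_fin fineK//.
  rewrite fin_num_measure//.
  exact: (@measurable_code_pred _ (borel_rV R N) (ball_code k) k
      (size_ball_code k) (@mbk k) (~` @fine_word R N r)).
near=> n.
have hn : `|\sum_(w : k.-tuple bool) h w * p w - \sum_(w : k.-tuple bool) h w * q n w| <= e / 8.
  by near: n; move/cvgrPdist_le : hq; exact.
move: fP (fmu n) hn; rewrite !ler_distl => /andP[a1 a2] /andP[b1 b2] /andP[c1 c2].
by apply/andP; split; lra.
Unshelve. all: by end_near. Qed.

Lemma realized_ultralimit : exists nu : probability (borel_rV R N) R,
  forall f : 'rV[R]_N -> R, measurable_fun [set: borel_rV R N] f ->
  forall B, (forall v, `|f v| <= B) ->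
  (forall e : R, 0 < e -> exists2 r : R, 0 < r &
     forall v w : 'rV[R]_N, (forall j, `|v 0 j - w 0 j| <= r) -> `|f v - f w| <= e) ->
  (fun n => \int[mu n]_v f v) @ U --> \int[nu]_v f v.
Proof.
have [nu nuX] := law_exists P measurable_X; exists nu => f mf B fB uf.
by rewrite (nuX f B mf fB); exact: cvg_expectation mf fB uf.
Qed.

End realized.

(** Plays the part of Prokhorov's theorem. Uniform continuity of f lets a single level of cells
    serve all n; cosines and sines of linear forms and truncated powers have it. *)
Lemma tight_ultralimit : exists nu : probability (borel_rV R N) R,
  forall f : 'rV[R]_N -> R, measurable_fun [set: borel_rV R N] f ->
  forall B, (forall v, `|f v| <= B) ->
  (forall e : R, 0 < e -> exists2 r : R, 0 < r &
     forall v w : 'rV[R]_N, (forall j, `|v 0 j - w 0 j| <= r) -> `|f v - f w| <= e) ->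
  (fun n => \int[mu n]_v f v) @ U --> \int[nu]_v f v.
Proof.
have [d [T [P [W [WS sizeW pW mW PW]]]]] := realization p_ge0 p_nil p_split.
exact: realized_ultralimit WS sizeW pW mW PW.
Qed.

End tight_limit.

(** * Moments and Fourier transforms *)

Lemma Rintegral_dominated_cvg {R : realType} d (T : measurableType d) (P : probability T R)
    (f : nat -> T -> R) (g h : T -> R) :
  (forall n, measurable_fun setT (f n)) -> measurable_fun setT g ->
  (forall x, f ^~ x @ \oo --> g x) ->
  P.-integrable setT (EFin \o h) -> (forall n x, `|f n x| <= h x) ->
  (fun n => \int[P]_x f n x) @ \oo --> \int[P]_x g x.
Proof.
move=> mf mg fg ih fh.
have ig : P.-integrable setT (EFin \o g).
  apply: le_integrable ih => //; first exact/measurable_EFinP.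
  move=> x _ /=; rewrite lee_fin; apply: le_trans (ler_norm _).
  by apply: (cvgr_to_le (cvg_norm (fg x))); exact: nearW.
apply: fine_cvg; rewrite fineK; last exact: integrable_fin_num.
apply: (@dominated_cvg _ _ _ P setT measurableT (fun n x => (f n x)%:E)
  (EFin \o g) (EFin \o h)) => //.
- by move=> n; exact/measurable_EFinP.
- by move=> x _; apply: cvg_EFin; [exact: nearW|exact: fg].
- by move=> n x _ /=; rewrite lee_fin.
Qed.

(** * Moments of real random variables from rescaled remainders *)

Section one_variable.
Context {R : realType} d (T : measurableType d) (P : probability T R).
Variables (Z : T -> R) (s : nat).
Hypothesis mZ : measurable_fun setT Z.
Hypothesis iZ : forall k, (k <= s)%N -> P.-integrable setT (EFin \o (fun x => Z x ^+ k)).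

Lemma measurable_trem k t : measurable_fun setT (fun x => trem k (t * Z x)).
Proof.
apply: (measurableT_comp (f := trem k)).
  exact: continuous_measurable_fun (@continuous_trem R k).
by apply: measurable_funM.
Qed.

Lemma integrable_trem k t : (k <= s)%N ->
  P.-integrable setT (EFin \o (fun x => trem k (t * Z x))).
Proof.
move=> ks; have := integrable_norm (integrable_mulr measurableT (t ^+ k / k`!%:R) (iZ ks)).
apply: le_integrable => //; first exact/measurable_EFinP/measurable_trem.
move=> x _ /=; rewrite lee_fin normr_id (le_trans (norm_trem_le _ _))//.
by rewrite !normrM !normrX normfV normr_nat exprMn mulrAC.
Qed.

Lemma expectation_tremS2 k t : (k <= s)%N ->
  \int[P]_x trem k.+2 (t * Z x) =
  t ^+ k / k`!%:R * \int[P]_x Z x ^+ k - \int[P]_x trem k (t * Z x).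
Proof.
move=> ks; rewrite -RintegralZl//; last exact: iZ.
rewrite -RintegralB//; last 2 first.
- by apply: integrable_mulr => //; exact: iZ.
- exact: integrable_trem.
by apply: eq_Rintegral => x _; rewrite tremS2 exprMn mulrAC.
Qed.

(** [trem k y] is y ^ k / k! - [trem k.+2 y], and the rescaled second term tends to 0 at each point.
    Dominated convergence applies with |Z| ^ k / k!, by [norm_trem_le]. *)
Lemma expectation_trem_cvg k : (k <= s)%N ->
  (fun n => n.+1%:R ^+ k * \int[P]_x trem k (n.+1%:R^-1 * Z x)) @ \oo -->
  (k`!%:R)^-1 * \int[P]_x Z x ^+ k.
Proof.
move=> ks.
under eq_cvg => n do rewrite -(RintegralZl _ measurableT (integrable_trem n.+1%:R^-1 ks)).
rewrite -(RintegralZl _ measurableT (iZ ks)).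
apply: (Rintegral_dominated_cvg (h := fun x => `|(k`!%:R)^-1 * Z x ^+ k|)).
- by move=> n; apply: measurable_funM => //; exact: measurable_trem.
- by apply: measurable_funM => //; exact: measurable_funX.
- move=> x; apply/cvgrPdist_le => r r0.
  pose c := `|Z x| ^+ k.+2 / (k.+2)`!%:R.
  have c0 : 0 <= c by rewrite divr_ge0// exprn_ge0.
  near=> n.
  have n0 : 0 < n.+1%:R :> R by rewrite ltr0n.
  rewrite (_ : _ - _ = n.+1%:R ^+ k * trem k.+2 (n.+1%:R^-1 * Z x)); last first.
    rewrite tremS2 mulrBr; congr (_ - _); rewrite exprMn exprVn.
    by field; rewrite gt_eqF ?exprn_gt0//= pnatr_eq0 -lt0n fact_gt0.
  rewrite normrM normrX normr_nat.
  apply: (@le_trans _ _ (n.+1%:R^-1 * c)).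
    apply: (@le_trans _ _ (n.+1%:R ^+ k * (n.+1%:R ^- k.+2 * c))).
      rewrite ler_wpM2l ?exprn_ge0// (le_trans (norm_trem_le _ _))//.
      by rewrite /c normrM exprMn normfV normr_nat exprVn -mulrA.
    rewrite mulrA ler_wpM2r// (_ : _ * _ = n.+1%:R^-1 * n.+1%:R^-1).
      by rewrite ler_piMr ?invr_ge0// invf_le1// ler1n.
    by rewrite !exprS; field; rewrite gt_eqF ?exprn_gt0//= gt_eqF.
  rewrite mulrC ler_pdivrMr// -ler_pdivrMl// mulrC.
  near: n; exists (Num.truncn (c / r)) => // n /= h.
  by rewrite ltW// (lt_le_trans (truncnS_gt _))// ler_nat ltnS.
- exact: (integrable_norm (integrable_mulr measurableT (k`!%:R)^-1 (iZ ks))).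
- move=> n x; rewrite normrM normrX normr_nat.
  have n0 : 0 < n.+1%:R :> R by rewrite ltr0n.
  rewrite -ler_pdivlMl ?exprn_gt0// (le_trans (norm_trem_le _ _))//.
  rewrite !normrM !normrX !normfV !normr_nat exprMn exprVn.
  by rewrite le_eqVlt; apply/orP; left; apply/eqP; ring.
Unshelve. all: by end_near. Qed.

End one_variable.

Section two_variables.
Context {R : realType}.
Context d1 (T1 : measurableType d1) (P1 : probability T1 R).
Context d2 (T2 : measurableType d2) (P2 : probability T2 R).
Variables (Z1 : T1 -> R) (Z2 : T2 -> R) (s : nat) (e : R).
Hypothesis mZ1 : measurable_fun setT Z1.
Hypothesis mZ2 : measurable_fun setT Z2.
Hypothesis iZ1 : forall k, (k <= s)%N -> P1.-integrable setT (EFin \o (fun x => Z1 x ^+ k)).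
Hypothesis iZ2 : forall k, (k <= s)%N -> P2.-integrable setT (EFin \o (fun x => Z2 x ^+ k)).

Let gap k t := \int[P1]_x trem k (t * Z1 x) - \int[P2]_x trem k (t * Z2 x).
Let moment_gap k := \int[P1]_x (Z1 x ^+ k) - \int[P2]_x (Z2 x ^+ k).

(** Passing from k to k + 2 adds a multiple of the k-th moment, which cancels in the difference, and
    flips the sign; what remains is cos for even k and sin for odd k. The highest moment involved
    has order k - 2, so k = s + 1 is still allowed. *)
Lemma norm_trem_gap k : (k <= s.+1)%N ->
  (forall j, (j.+1 < k)%N -> \int[P1]_x (Z1 x ^+ j) = \int[P2]_x (Z2 x ^+ j)) ->
  forall t, `|\int[P1]_x trem k (t * Z1 x) - \int[P2]_x trem k (t * Z2 x)| =
    `|\int[P1]_x trem (odd k) (t * Z1 x) - \int[P2]_x trem (odd k) (t * Z2 x)|.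
Proof.
elim/nat_ind2: k => [//|//|k IH] ks eqm t; have {}ks : (k <= s)%N := ltnW ks.
rewrite (expectation_tremS2 mZ1 iZ1 _ ks) (expectation_tremS2 mZ2 iZ2 _ ks).
rewrite (eqm k)// opprD opprK addrACA subrr add0r addrC distrC /= negbK.
by apply: IH => [|j jk]; [exact: leqW|apply: eqm; rewrite (ltn_trans jk)].
Qed.

Hypothesis near_cos : forall t,
  `|\int[P1]_x cos (t * Z1 x) - \int[P2]_x cos (t * Z2 x)| <= e * `|t| ^+ s.
Hypothesis near_sin : forall t,
  `|\int[P1]_x sin (t * Z1 x) - \int[P2]_x sin (t * Z2 x)| <= e * `|t| ^+ s.

Let gap_le k : (k <= s)%N -> (forall j, (j < k)%N -> moment_gap j = 0) ->
  forall t, `|gap k t| <= e * `|t| ^+ s.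
Proof.
move=> ks gap0 t; rewrite [leLHS]norm_trem_gap ?leqW// => [|j /ltnW jk].
  by case: (odd k); [exact: near_sin|exact: near_cos].
by apply/eqP; rewrite -subr_eq0; apply/eqP/gap0.
Qed.

Let gap_cvg k : (k <= s)%N ->
  (fun n => n.+1%:R ^+ k * gap k n.+1%:R^-1) @ \oo --> (k`!%:R)^-1 * moment_gap k.
Proof.
move=> ks; rewrite [X in _ --> X]mulrBr.
under eq_cvg do rewrite mulrBr.
by apply: cvgB; apply: (expectation_trem_cvg (s := s)).
Qed.

(** By strong induction the lower moments agree, so the gap of order k is at most e |t| ^ s.
    Multiplied by (n + 1) ^ k at t = 1 / (n + 1), this bound is e / (n + 1) ^ (s - k), while the gap
    tends to the difference of the k-th moments over k!. The limit in n gives 0 for k < s and e k!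
    for k = s. *)
Lemma moment_gap_le k : (k <= s)%N ->
  `|moment_gap k| <= if k == s then e * k`!%:R else 0.
Proof.
elim/ltn_ind: k => k IH ks.
have gap0 j : (j < k)%N -> moment_gap j = 0.
  move=> jk; have js : (j < s)%N := leq_trans jk ks.
  by apply/eqP; have := IH j jk (ltnW js); rewrite ltn_eqF// normr_le0.
have e0 : 0 <= e.
  by have := near_cos 1; rewrite normr1 expr1n mulr1; apply: le_trans.
have bound n : `|n.+1%:R ^+ k * gap k n.+1%:R^-1| <= e * n.+1%:R ^- (s - k).
  have n0 : 0 < n.+1%:R :> R by rewrite ltr0n.
  rewrite normrM normrX normr_nat -ler_pdivlMl ?exprn_gt0//.
  rewrite (le_trans (gap_le ks gap0 _))// normfV normr_nat exprVn.
  have -> : n.+1%:R ^- s = n.+1%:R ^- k * n.+1%:R ^- (s - k) :> R.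
    by rewrite -invfM -exprD subnKC.
  by rewrite mulrCA.
have cvg_k : (fun n => `|n.+1%:R ^+ k * gap k n.+1%:R^-1|) @ \oo -->
    (k`!%:R)^-1 * `|moment_gap k|.
  have := cvg_norm (gap_cvg ks).
  by rewrite normrM normfV normr_nat; exact.
case: ifPn => [/eqP kE|kns].
  rewrite mulrC -ler_pdivrMl ?ltr0n ?fact_gt0//.
  apply: (cvgr_to_le cvg_k); apply: nearW => n.
  by rewrite (le_trans (bound n))// kE subnn expr0 invr1 mulr1.
have k0 : (0 : R) < (k`!%:R)^-1 by rewrite invr_gt0 ltr0n fact_gt0.
rewrite -(pmulr_rle0 _ k0); apply/ler_addgt0Pr => r r0; rewrite add0r.
apply: (cvgr_to_le cvg_k); near=> n.
rewrite (le_trans (bound n))//.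
apply: (@le_trans _ _ (e / n.+1%:R)).
  rewrite ler_wpM2l// lef_pV2 ?posrE ?exprn_gt0 ?ltr0n//.
  by rewrite ler_eXnr// ?ler1n// subn_gt0 ltn_neqAle kns.
rewrite ler_pdivrMr ?ltr0n// -ler_pdivrMl// mulrC.
near: n; exists (Num.truncn (e / r)) => // n /= h.
by rewrite ltW// (lt_le_trans (truncnS_gt _))// ler_nat ltnS.
Unshelve. all: by end_near. Qed.

End two_variables.

(** * Multi-indices and powers of linear forms *)

Section fiber_counts.
Context {R : realType} {N k : nat}.
Implicit Types (f : {ffun 'I_k -> 'I_N}) (b : {ffun 'I_N -> nat}).

(** A function f picks one coordinate in each of the k factors of [dotp x v ^+ k]. Summing over f
    instead of over multi-indices keeps the multinomial coefficients implicit, as numbers of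
    functions with a given count. *)
Definition fiber_count f : {ffun 'I_N -> nat} := [ffun i => #|[pred j | f j == i]|].

Lemma mideg_fiber_count f : mideg (fiber_count f) = k.
Proof.
rewrite /mideg -[RHS]card_ord -sum1_card (partition_big f xpredT)//=.
by apply: eq_bigr => i _; rewrite ffunE -sum1_card; apply: eq_bigl => j; rewrite inE.
Qed.

Lemma monomial_fiber_count f (v : 'rV[R]_N) :
  monomial (fiber_count f) v = \prod_j v 0 (f j).
Proof.
rewrite (partition_big f xpredT)//=; apply: eq_bigr => i _.
rewrite (eq_bigr (fun=> v 0 i)) => [|j /eqP->//].
by rewrite prodr_const ffunE.
Qed.

Lemma dotpX (x v : 'rV[R]_N) :
  dotp x v ^+ k = \sum_f monomial (fiber_count f) x * monomial (fiber_count f) v.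
Proof.
transitivity (\prod_(j < k) \sum_i x 0 i * v 0 i).
  by rewrite prodr_const card_ord.
rewrite bigA_distr_bigA/=; apply: eq_bigr => f _.
by rewrite big_split/= !monomial_fiber_count.
Qed.

Lemma fiber_count_surj b : mideg b = k -> exists f, fiber_count f = b.
Proof.
move=> bk; pose s := flatten [seq nseq (b i) i | i <- enum 'I_N].
have ss : size s = k.
  rewrite size_flatten /shape -map_comp sumnE big_map -[RHS]bk /mideg big_enum/=.
  by apply: eq_bigr => i _; rewrite size_nseq.
pose t := tcast ss (in_tuple s).
exists (finfun (tnth t)); apply/ffunP => i; rewrite ffunE.
transitivity (count_mem i t).
  rewrite -[in RHS](map_tnth_enum t) count_map -sum1_card -sum1_count big_enum_cond/=.
  by apply: eq_bigl => j; rewrite /= inE ffunE.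
rewrite val_tcast /= /s count_flatten -map_comp sumnE big_map big_enum/=.
rewrite (bigD1 i)//= count_nseq /= eqxx mul1n big1 ?addn0// => j ji.
by rewrite count_nseq /= (negbTE ji).
Qed.

Lemma digits_inj (B : nat) (m : nat) (b c : 'I_m -> nat) :
  (forall i, (b i < B)%N) -> (forall i, (c i < B)%N) ->
  (\sum_i b i * B ^ i = \sum_i c i * B ^ i)%N -> b =1 c.
Proof.
elim: m b c => [|m IH] b c bB cB; first by move=> _ [].
rewrite !big_ord_recl/= !expn0 !muln1 => bc.
have tailE (a : 'I_m.+1 -> nat) :
    (\sum_(i < m) a (lift ord0 i) * B ^ bump 0 i =
     (\sum_(i < m) a (lift ord0 i) * B ^ i) * B)%N.
  by rewrite big_distrl/=; apply: eq_bigr => i _; rewrite /bump leq0n add1n expnSr mulnA.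
rewrite !tailE in bc.
have bc0 : b ord0 = c ord0.
  by have := congr1 (modn^~ B) bc; rewrite /= ![(_ + _ * B)%N]addnC !modnMDl !modn_small.
have B0 : (0 < B)%N := leq_ltn_trans (leq0n _) (bB ord0).
have /eqP := bc; rewrite bc0 eqn_add2l eqn_pmul2r// => /eqP bcS i.
have tl := IH (b \o lift ord0) (c \o lift ord0) (fun i => bB _) (fun i => cB _) bcS.
by have [j ->|->] := unliftP ord0 i; [exact: tl j|exact: bc0].
Qed.

(** A form of degree k that vanishes everywhere has zero coefficients. The coefficient at b is [c b]
    times the number of f with count b, and this number is positive. It serves to recover single
    moments from those of all [dotp x]. *)
Lemma fiber_sum_eq0 (c : {ffun 'I_N -> nat} -> R) :
  (forall x : 'rV[R]_N, \sum_f monomial (fiber_count f) x * c (fiber_count f) = 0) ->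
  forall b, mideg b = k -> c b = 0.
Proof.
move=> c0 b bk.
(* Kronecker substitution: [x_i = y ^ (k.+1 ^ i)] sends distinct monomials of
   degree k to distinct powers of y. *)
pose code (a : {ffun 'I_N -> nat}) := (\sum_i a i * k.+1 ^ i)%N.
have small (a : {ffun 'I_N -> nat}) : mideg a = k -> forall i, (a i < k.+1)%N.
  by move=> <- i; rewrite ltnS /mideg (bigD1 i)//= leq_addr.
pose p : {poly R} := \sum_f (c (fiber_count f))%:P * 'X^(code (fiber_count f)).
have py y : p.[y] = 0.
  rewrite -[RHS](c0 (\row_i y ^+ (k.+1 ^ i))) horner_sum; apply: eq_bigr => f _.
  rewrite !hornerE mulrC; congr (_ * _).
  rewrite /monomial /code -prodrXr; apply: eq_bigr => i _.
  by rewrite mxE -exprM mulnC.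
have p0 : p = 0.
  (* The integers below [size p] are more roots than a nonzero p can have. *)
  apply: (@roots_geq_poly_eq0 _ p [seq i%:R | i <- iota 0 (size p)]).
  - by apply/allP => y _; apply/eqP/py.
  - rewrite map_inj_uniq ?iota_uniq// => i j /eqP; rewrite eqr_nat => /eqP//.
  - by rewrite size_map size_iota.
have := congr1 (fun q : {poly R} => q`_(code b)) p0; rewrite coef0 coef_sum.
have [g gb] := fiber_count_surj bk.
(* By uniqueness of digits in base k + 1, only the f with count b reach this coefficient; g is one
   of them. *)
rewrite (eq_bigr (fun f => if fiber_count f == b then c b else 0)); last first.
  move=> f _; rewrite coefCM coefXn; have [->|fb] := eqVneq (fiber_count f) b; first by rewrite eqxx mulr1.
  case: eqP => [bf|_]; last by rewrite mulr0.
  case/eqP: fb; apply/ffunP => i; apply: esym.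
  exact: (@digits_inj k.+1 N b (fiber_count f) (small _ bk) (small _ (mideg_fiber_count f)) bf i).
rewrite -big_mkcond/= sumr_const => /eqP; rewrite mulrn_eq0 => /orP[/eqP g0|/eqP//].
by have := card0_eq g0 g; rewrite [LHS](introT eqP gb).
Qed.

End fiber_counts.

(** * Fourier transforms of measures with finite moments *)

Section fourier_transforms.
Context {R : realType} {N : nat}.
Implicit Types (x v w : 'rV[R]_N) (mu nu : probability (borel_rV R N) R).

Lemma norm_Re_le_normc (a b : R) : `|a| <= Normc.normc (Complex a b).
Proof. by rewrite /= -sqrtr_sqr ler_wsqrtr// lerDl sqr_ge0. Qed.

Lemma norm_Im_le_normc (a b : R) : `|b| <= Normc.normc (Complex a b).
Proof. by rewrite /= -sqrtr_sqr ler_wsqrtr// lerDr sqr_ge0. Qed.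

Lemma normc_le (a b : R) : Normc.normc (Complex a b) <= `|a| + `|b|.
Proof.
rewrite /= -[leRHS]ger0_norm ?addr_ge0// -sqrtr_sqr ler_wsqrtr//.
by rewrite sqrrD !real_normK ?num_real// -addrA lerD2l lerDr mulrn_wge0// mulr_ge0.
Qed.

Lemma enorm_gt0 x : x != 0 -> 0 < enorm x.
Proof.
move=> /eqP x0; rewrite sqrtr_gt0 lt0r sumr_ge0 ?andbT => [|i _]; last exact: sqr_ge0.
apply/eqP => /eqP; rewrite psumr_eq0 => [/allP h|i _]; last exact: sqr_ge0.
apply: x0; apply/rowP => i; rewrite mxE; apply/eqP.
by rewrite -sqrf_eq0; apply: h; rewrite mem_index_enum.
Qed.

Lemma normc_distD (a b c : R[i]) :
  Normc.normc (a - c) <= Normc.normc (a - b) + Normc.normc (b - c).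
Proof.
rewrite -lecR rmorphD -[X in X <= _]/`|a - c|.
by rewrite (le_trans (ler_distD b _ _)).
Qed.

Lemma normc_distC (a b : R[i]) : Normc.normc (a - b) = Normc.normc (b - a).
Proof. by have := distrC a b => -[]. Qed.

Lemma enormZ (t : R) x : enorm (t *: x) = `|t| * enorm x.
Proof.
rewrite /enorm -sqrtr_sqr -sqrtrM ?sqr_ge0//; congr Num.sqrt.
by rewrite mulr_sumr; apply: eq_bigr => i _; rewrite mxE exprMn.
Qed.

Lemma dotpZl (t : R) x v : dotp (t *: x) v = t * dotp x v.
Proof. by rewrite /dotp mulr_sumr; apply: eq_bigr => i _; rewrite mxE mulrA. Qed.

Lemma measurable_dotp x : measurable_fun [set: borel_rV R N] (dotp x).
Proof.
apply: measurable_sum => i; apply: measurable_funM => //; exact: measurable_coord.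
Qed.

Lemma measurable_cos_dotp x : measurable_fun [set: borel_rV R N] (fun v => cos (dotp x v)).
Proof.
apply: (measurableT_comp (f := @cos R)); last exact: measurable_dotp.
exact: continuous_measurable_fun (@continuous_cos R).
Qed.

Lemma measurable_sin_dotp x : measurable_fun [set: borel_rV R N] (fun v => sin (dotp x v)).
Proof.
apply: (measurableT_comp (f := @sin R)); last exact: measurable_dotp.
exact: continuous_measurable_fun (@continuous_sin R).
Qed.

Lemma measurable_monomial b : measurable_fun [set: borel_rV R N] (monomial b).
Proof.
apply: measurable_prod => i _; apply: measurable_funX; exact: measurable_coord.
Qed.

Lemma norm_le_of_is_derive (f df : R -> R) (a b : R) :
  (forall y : R, is_derive y 1 f (df y)) -> (forall y, `|df y| <= 1) ->
  `|f a - f b| <= `|a - b|.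
Proof.
move=> fdf df1; wlog ba : a b / b <= a.
  by move=> h; case/orP: (le_total b a) => /h// h'; rewrite distrC (distrC a).
have cf : {within `[b, a], continuous f}.
  by apply: continuous_subspaceT; exact: is_derive_continuous fdf.
have [c _ ->] := MVT_segment ba (fun y _ => fdf y) cf.
by rewrite normrM ler_piMl.
Qed.

Lemma norm_cosB_le (a b : R) : `|cos a - cos b| <= `|a - b|.
Proof.
apply: (norm_le_of_is_derive a b (@is_derive_cos R)) => y.
by rewrite normrN sin_max.
Qed.

Lemma norm_sinB_le (a b : R) : `|sin a - sin b| <= `|a - b|.
Proof.
apply: (norm_le_of_is_derive a b (@is_derive_sin R)) => y.
exact: cos_max.
Qed.

Lemma norm_dotpB_le x v w (r : R) : (forall j, `|v 0 j - w 0 j| <= r) ->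
  `|dotp x v - dotp x w| <= (\sum_i `|x 0 i|) * r.
Proof.
move=> vw; rewrite /dotp -sumrB mulr_suml (le_trans (ler_norm_sum _ _ _))//.
by apply: ler_sum => i _; rewrite -mulrBr normrM ler_wpM2l.
Qed.

Lemma dotp_unif_continuous (g : R -> R) x : (forall a b, `|g a - g b| <= `|a - b|) ->
  forall e : R, 0 < e -> exists2 r : R, 0 < r & forall v w : 'rV[R]_N,
    (forall j, `|v 0 j - w 0 j| <= r) -> `|g (dotp x v) - g (dotp x w)| <= e.
Proof.
move=> g1 e e0; pose c := \sum_i `|x 0 i|.
have c0 : 0 < c + 1 by rewrite ltr_wpDl// sumr_ge0.
exists (e / (c + 1)); first by rewrite divr_gt0.
move=> v w vw; rewrite (le_trans (g1 _ _))// (le_trans (norm_dotpB_le x vw))//.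
by rewrite mulrCA ler_piMr ?ltW// ltr_pdivrMr// mul1r ltrDl.
Qed.

Lemma fourier0 mu nu : fourier mu 0 = fourier nu 0.
Proof.
suff h (m : probability (borel_rV R N) R) : fourier m 0 = Complex 1 0 by rewrite !h.
have d0 v : dotp 0 v = 0 by rewrite /dotp big1// => i _; rewrite mxE mul0r.
rewrite /fourier; under eq_Rintegral do rewrite d0 cos0.
rewrite Rintegral_prob_cst; congr Complex.
by under eq_Rintegral do rewrite d0 sin0; rewrite Rintegral_prob_cst oppr0.
Qed.

(** At x = 0, which the supremum leaves out, both transforms equal 1. *)
Lemma normc_le_of_fdist s mu nu (e : R) : 0 < e -> (fdist s mu nu < e%:E)%E ->
  forall x, Normc.normc (fourier mu x - fourier nu x) <= e * enorm x ^+ s.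
Proof.
move=> e0 mn x; have [->|x0] := eqVneq x 0.
  by rewrite (fourier0 mu nu) subrr Normc.normc0 mulr_ge0 ?(ltW e0)// exprn_ge0// sqrtr_ge0.
rewrite -ler_pdivrMr ?exprn_gt0 ?enorm_gt0// -lee_fin (le_trans _ (ltW mn))//.
by apply: ereal_sup_ubound; exists x.
Qed.

Lemma fdist_le_of_normc s mu nu (e : R) :
  (forall x, x != 0 -> Normc.normc (fourier mu x - fourier nu x) <= e * enorm x ^+ s) ->
  (fdist s mu nu <= e%:E)%E.
Proof.
move=> h; apply: ge_ereal_sup => _ [x /= x0 <-]; rewrite lee_fin.
by rewrite ler_pdivrMr ?exprn_gt0 ?enorm_gt0// h.
Qed.

Lemma norm_cosB_le_normc mu nu x :
  `|\int[mu]_v cos (dotp x v) - \int[nu]_v cos (dotp x v)|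
    <= Normc.normc (fourier mu x - fourier nu x).
Proof. exact: norm_Re_le_normc. Qed.

Lemma norm_sinB_le_normc mu nu x :
  `|\int[mu]_v sin (dotp x v) - \int[nu]_v sin (dotp x v)|
    <= Normc.normc (fourier mu x - fourier nu x).
Proof. by rewrite -normrN opprD; exact: norm_Im_le_normc. Qed.

Lemma normc_fourierB_le mu nu x : Normc.normc (fourier mu x - fourier nu x) <=
  `|\int[mu]_v cos (dotp x v) - \int[nu]_v cos (dotp x v)| +
  `|\int[mu]_v sin (dotp x v) - \int[nu]_v sin (dotp x v)|.
Proof.
rewrite -(normrN (_ - \int[nu]_v sin (dotp x v))) opprD.
exact: normc_le.
Qed.

Lemma integrable_dotpX mu s : (forall b, (mideg b <= s)%N ->
    mu.-integrable [set: borel_rV R N] (EFin \o monomial b)) ->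
  forall x k, (k <= s)%N -> mu.-integrable [set: borel_rV R N] (EFin \o (fun v => dotp x v ^+ k)).
Proof.
move=> im x k ks.
rewrite (_ : _ \o _ = fun v : borel_rV R N => \sum_(f : {ffun 'I_k -> 'I_N})
    (monomial (fiber_count f) x * monomial (fiber_count f) v)%:E)%E; last first.
  by apply/funext => v /=; rewrite dotpX sumEFin.
apply: integrable_sum => // f _.
by apply: integrable_mulr => //; apply: im; rewrite mideg_fiber_count.
Qed.

Lemma expectation_dotpX mu s : (forall b, (mideg b <= s)%N ->
    mu.-integrable [set: borel_rV R N] (EFin \o monomial b)) ->
  forall x k, (k <= s)%N -> \int[mu]_v dotp x v ^+ k =
    \sum_(f : {ffun 'I_k -> 'I_N})
      monomial (fiber_count f) x * \int[mu]_v monomial (fiber_count f) v.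
Proof.
move=> im x k ks.
have imf (f : {ffun 'I_k -> 'I_N}) : mu.-integrable setT (EFin \o monomial (fiber_count f)).
  by apply: im; rewrite mideg_fiber_count.
under eq_Rintegral do rewrite dotpX.
rewrite Rintegral_sum//; last by move=> f; exact: integrable_mulr.
by apply: eq_bigr => f _; rewrite -[RHS]RintegralZl.
Qed.

(** On the line spanned by x the transform is that of the real variable [dotp x], and |t x| ^ s =
    |t| ^ s |x| ^ s, so [moment_gap_le] compares the powers of [dotp x] under mu and nu. As nu has
    moments M whatever e is, letting e tend to 0 shows that the form in x built from the moments of
    mu minus M vanishes, and [fiber_sum_eq0] applies. *)
Lemma has_moment_of_fourier s (M : {ffun 'I_N -> nat} -> R) mu : (0 < s)%N ->
  (forall b, (mideg b <= s)%N ->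
    mu.-integrable [set: borel_rV R N] (EFin \o monomial b)) ->
  (forall e, 0 < e -> exists nu,
    (forall b, (mideg b <= s)%N -> has_moment nu b (M b)) /\
    forall x, Normc.normc (fourier mu x - fourier nu x) <= e * enorm x ^+ s) ->
  forall b, (mideg b <= s)%N -> has_moment mu b (M b).
Proof.
move=> s0 im approx b bs; split; first exact: im.
rewrite -[LHS]fineK; last by apply: integrable_fin_num => //; exact: im.
congr EFin; apply/eqP; rewrite -subr_eq0; apply/eqP.
apply: (@fiber_sum_eq0 R N (mideg b) (fun a => \int[mu]_v monomial a v - M a)) => // x.
pose A := enorm x ^+ s * (mideg b)`!%:R.
have A0 : 0 <= A by rewrite mulr_ge0 ?exprn_ge0 ?sqrtr_ge0.
apply/eqP; rewrite -normr_le0; apply/ler_addgt0Pr => r r0; rewrite add0r.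
(* A vanishes at x = 0, whence A + 1. *)
have e0 : 0 < r / (A + 1) by rewrite divr_gt0// ltr_wpDl.
have [nu [nuM munu]] := approx _ e0.
have inu a : (mideg a <= s)%N -> nu.-integrable setT (EFin \o monomial a).
  by move=> /nuM[].
rewrite [X in `|X|](_ : _ = \int[mu]_v dotp x v ^+ mideg b - \int[nu]_v dotp x v ^+ mideg b); last first.
  rewrite (expectation_dotpX im)// (expectation_dotpX inu)// -sumrB.
  apply: eq_bigr => f _; rewrite mulrBr; congr (_ - _ * _).
  by rewrite /Rintegral; case: (nuM (fiber_count f)) => [|_ ->//]; rewrite mideg_fiber_count.
have nt t : Normc.normc (fourier mu (t *: x) - fourier nu (t *: x)) <=
    r / (A + 1) * enorm x ^+ s * `|t| ^+ s.
  by rewrite (le_trans (munu _))// enormZ exprMn mulrA mulrAC.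
have := @moment_gap_le R _ _ mu _ _ nu (dotp x) (dotp x) s (r / (A + 1) * enorm x ^+ s)
  (measurable_dotp x) (measurable_dotp x) (integrable_dotpX im x) (integrable_dotpX inu x).
move=> /(_ _ _ _ bs) gap_le.
have {}gap_le : `|\int[mu]_v dotp x v ^+ mideg b - \int[nu]_v dotp x v ^+ mideg b| <=
    if mideg b == s then r / (A + 1) * enorm x ^+ s * (mideg b)`!%:R else 0.
  apply: gap_le => t.
    under eq_Rintegral do rewrite -dotpZl.
    under [X in _ - X]eq_Rintegral do rewrite -dotpZl.
    exact: le_trans (norm_cosB_le_normc _ _ _) (nt t).
  under eq_Rintegral do rewrite -dotpZl.
  under [X in _ - X]eq_Rintegral do rewrite -dotpZl.
  exact: le_trans (norm_sinB_le_normc _ _ _) (nt t).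
apply: (le_trans gap_le); case: ifP => _; last exact: ltW.
rewrite -mulrA -/A mulrAC ler_pdivrMr ?ltr_wpDl// ler_wpM2l ?ltW//.
by rewrite ltrDl.
Qed.

End fourier_transforms.

(** * Even order *)

Section even_order.
Context {R : realType} {N : nat}.
Implicit Types (v w : 'rV[R]_N) (mu nu : probability (borel_rV R N) R).

(** With t the maximum of 1 and the |v_j|, the monomial is at most t ^ |b| <= t ^ s, and t ^ s is
    one of the summands on the right. *)
Lemma norm_monomial_le s b v : (mideg b <= s)%N ->
  `|monomial b v| <= 1 + \sum_j `|v 0 j| ^+ s.
Proof.
move=> bs.
have [t [t1 vt ts]] : exists t : R, [/\ 1 <= t, forall j, `|v 0 j| <= t &
    t ^+ s <= 1 + \sum_j `|v 0 j| ^+ s].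
  have s0 : 0 <= \sum_j `|v 0 j| ^+ s by apply: sumr_ge0 => j _; exact: exprn_ge0.
  have [[j0 j01]|none] := pselect (exists j, 1 < `|v 0 j|); last first.
    exists 1; split => // [j|]; last by rewrite expr1n lerDl.
    by rewrite leNgt; apply/negP => h; apply: none; exists j.
  case: (@arg_maxP _ _ _ j0 xpredT (fun j => `|v 0 j|)) => // j _ jmax.
  exists `|v 0 j|; split => //.
  - by apply: le_trans (ltW j01) _; exact: jmax.
  - by move=> i; exact: jmax.
  rewrite (bigD1 j)//= addrCA lerDl; apply: addr_ge0 => //.
  by apply: sumr_ge0 => i _; exact: exprn_ge0.
rewrite (le_trans _ ts)// (le_trans _ (ler_weXn2l t1 bs))//.
rewrite /monomial /mideg normr_prod expr_sum ler_prod// => i _.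
by rewrite normrX exprn_ge0//= lerXn2r ?nnegrE// (le_trans _ t1).
Qed.

Lemma integrable_monomial mu s b : (mideg b <= s)%N ->
  (forall j, mu.-integrable [set: borel_rV R N] (EFin \o (fun v => `|v 0 j| ^+ s))) ->
  mu.-integrable [set: borel_rV R N] (EFin \o monomial b).
Proof.
move=> bs iv.
have isum : mu.-integrable [set: borel_rV R N] (fun v => \sum_j (`|v 0 j| ^+ s)%:E)%E.
  by apply: integrable_sum => // j _; exact: iv.
have i1 : mu.-integrable [set: borel_rV R N] (EFin \o cst 1).
  apply: (@bounded_integrable _ _ _ _ _ 1) => // v; by rewrite normr1.
apply: le_integrable (integrableD measurableT i1 isum) => //.
  by apply/measurable_EFinP; exact: measurable_monomial.
move=> v _ /=; rewrite sumEFin lee_fin ger0_norm ?norm_monomial_le// addr_ge0//.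
by apply: sumr_ge0 => j _; exact: exprn_ge0.
Qed.

Lemma integrable_of_approximations d (T : measurableType d) (P : probability T R)
    (f : nat -> T -> R) (g : T -> R) (c : R) :
  (forall n, measurable_fun setT (f n)) -> measurable_fun setT g ->
  (forall n x, 0 <= f n x) -> (forall x, nondecreasing_seq (f ^~ x)) ->
  (forall x, f ^~ x @ \oo --> g x) ->
  (forall n, P.-integrable setT (EFin \o f n)) ->
  (forall n, \int[P]_x f n x <= c) -> P.-integrable setT (EFin \o g).
Proof.
move=> mf mg f0 ndf fg fi fc.
have g0 x : 0 <= g x.
  by apply: (cvgr_to_ge (fg x)); exact: nearW.
apply/integrableP; split; first exact/measurable_EFinP.
rewrite (eq_integral (fun x => limn (fun n => (f n x)%:E))); last first.
  move=> x _; rewrite /= ger0_norm//; apply/esym/cvg_lim => //.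
  by apply: cvg_EFin; [exact: nearW|exact: fg].
rewrite monotone_convergence//; last 3 first.
- by move=> n; exact/measurable_EFinP.
- by move=> n x _; rewrite lee_fin.
- by move=> x _ m n mn; rewrite lee_fin ndf.
apply: (@le_lt_trans _ _ c%:E); last exact: ltry.
apply: lime_le.
  apply: ereal_nondecreasing_is_cvgn => m n mn; apply: ge0_le_integral => //.
  - by move=> x _; rewrite lee_fin.
  - exact/measurable_EFinP.
  - exact/measurable_EFinP.
  - by move=> x _; rewrite lee_fin ndf.
apply: nearW => n; rewrite -[leLHS]fineK; first by rewrite lee_fin; exact: fc.
by apply: integrable_fin_num => //; exact: fi.
Qed.

Lemma norm_subXn_le (a b K : R) n : 0 <= a <= K -> 0 <= b <= K ->
  `|a ^+ n - b ^+ n| <= n%:R * K ^+ n.-1 * `|a - b|.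
Proof.
move=> /andP[a0 aK] /andP[b0 bK]; rewrite subrXX normrM mulrC ler_wpM2r//.
rewrite (le_trans (ler_norm_sum _ _ _))//.
apply: (@le_trans _ _ (\sum_(i < n) K ^+ n.-1)); last first.
  by rewrite sumr_const card_ord mulr_natl.
apply: ler_sum => i _; have -> : n.-1 = ((n.-1 - i) + i)%N.
  by rewrite subnK//; case: n i => [[]//|n] i; rewrite -ltnS ltn_ord.
rewrite ger0_norm ?mulr_ge0 ?exprn_ge0// exprD ler_pM ?exprn_ge0//.
  by rewrite -subn1 -subnDA add1n addnK subnS lerXn2r ?nnegrE// (le_trans a0).
by rewrite lerXn2r ?nnegrE// (le_trans b0).
Qed.

Lemma norm_minB_le (a b K : R) : `|Num.min a K - Num.min b K| <= `|a - b|.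
Proof.
wlog ab : a b / a <= b.
  by move=> h; case/orP: (le_total a b) => /h// h'; rewrite distrC (distrC a).
rewrite distrC (distrC a) !ger0_norm ?subr_ge0//.
  by rewrite /Num.min; case: ltP => ?; case: ltP => ?; lra.
by rewrite le_min !ge_min ab lexx orbT.
Qed.

(** Bounded and uniformly continuous, hence an admissible test function for [tight_ultralimit], and
    increasing in n to |v_j| ^ s. *)
Definition trunc_pow (s n : nat) (j : 'I_N) (v : 'rV[R]_N) : R :=
  Num.min `|v 0 j| n%:R ^+ s.

Lemma trunc_pow_itv s n j v : 0 <= trunc_pow s n j v <= n%:R ^+ s.
Proof.
have m0 : 0 <= Num.min `|v 0 j| n%:R by rewrite le_min normr_ge0 ler0n.
by rewrite exprn_ge0//= lerXn2r ?nnegrE// ge_min lexx orbT.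
Qed.

Lemma measurable_trunc_pow s n j : measurable_fun [set: borel_rV R N] (trunc_pow s n j).
Proof.
apply: measurable_funX; apply: measurable_minr => //.
apply: measurableT_comp => //; exact: measurable_coord.
Qed.

Lemma trunc_pow_unif_continuous s n j (e : R) : 0 < e -> exists2 r : R, 0 < r &
  forall v w, (forall i, `|v 0 i - w 0 i| <= r) -> `|trunc_pow s n j v - trunc_pow s n j w| <= e.
Proof.
move=> e0; pose c : R := s%:R * n%:R ^+ s.-1.
have c0 : 0 < c + 1 by rewrite ltr_wpDl// mulr_ge0// exprn_ge0.
exists (e / (c + 1)); first by rewrite divr_gt0.
move=> v w vw; have m0 (u : 'rV[R]_N) : 0 <= Num.min `|u 0 j| n%:R <= n%:R.
  by rewrite le_min normr_ge0 ler0n ge_min lexx orbT.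
rewrite (le_trans (norm_subXn_le s (m0 v) (m0 w)))// -/c.
apply: (@le_trans _ _ (c * (e / (c + 1)))).
  rewrite ler_wpM2l ?mulr_ge0 ?exprn_ge0// (le_trans (norm_minB_le _ _ _))//.
  by rewrite (le_trans (ler_dist_dist _ _))//.
by rewrite mulrCA ler_piMr ?ltW// ltr_pdivrMr// mul1r ltrDl.
Qed.

Lemma trunc_pow_cvg s j v : (fun n => trunc_pow s n j v) @ \oo --> `|v 0 j| ^+ s.
Proof.
apply: cvg_near_cst; exists (Num.truncn `|v 0 j|).+1 => // n /= h.
rewrite /trunc_pow min_l// ltW// (lt_le_trans (truncnS_gt _))//.
by rewrite ler_nat.
Qed.

(** Markov's inequality for the sum of the |v_j| ^ s. *)
Lemma tail_le mu s (K c : R) : 0 < K ->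
  (forall j, mu.-integrable [set: borel_rV R N] (EFin \o (fun v => `|v 0 j| ^+ s))) ->
  \sum_j \int[mu]_v (`|v 0 j| ^+ s) <= c ->
  (mu [set v | exists j, (K < `|v 0 j|)%R] <= (c / K ^+ s)%:E)%E.
Proof.
move=> K0 iv Sc.
apply: (@le_trans _ _ ((\sum_j \int[mu]_v (`|v 0 j| ^+ s)) / K ^+ s)%:E); last first.
  by rewrite lee_fin ler_pM2r// invr_gt0 exprn_gt0.
pose A : set (borel_rV R N) := [set v | exists j, K < `|v 0 j|].
have mA : measurable A := measurable_tail K.
rewrite -[X in (X <= _)%E]/(mu A).
rewrite -[leLHS]fineK ?fin_num_measure// lee_fin ler_pdivlMr ?exprn_gt0// mulrC.
have iA : mu.-integrable setT (EFin \o (\1_A : borel_rV R N -> R)).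
  apply: (@bounded_integrable _ _ _ _ _ 1) => [|v]; first exact: measurable_indic.
  by rewrite indicE; case: (_ \in _); rewrite ?normr1 ?normr0.
rewrite -(Rintegral_indic mu mA) -RintegralZl// (_ : \sum_j _ = \int[mu]_v (\sum_j `|v 0 j| ^+ s)).
  apply: le_Rintegral => //.
  - exact: integrable_mulr.
  - rewrite (_ : _ \o _ = fun v : borel_rV R N => \sum_j (`|v 0 j| ^+ s)%:E)%E.
      by apply: integrable_sum => // j _; exact: iv.
    by apply/funext => v /=; rewrite sumEFin.
  - move=> v _; have s0 : 0 <= \sum_j `|v 0 j| ^+ s.
      by apply: sumr_ge0 => j _; exact: exprn_ge0.
    rewrite indicE; have [[j Kv]|nA] := pselect (A v); last by rewrite memNset// mulr0.
    rewrite mem_set ?mulr1; last by exists j.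
    rewrite (bigD1 j)//= ler_wpDr//; last by rewrite lerXn2r ?nnegrE// ltW.
    by apply: sumr_ge0 => i _; exact: exprn_ge0.
by rewrite Rintegral_sum.
Qed.

End even_order.

(** * Completeness for even order *)

Section even_complete.
Context {R : realType} {N : nat} (s : nat) (M : {ffun 'I_N -> nat} -> R).
Hypothesis s0 : (0 < s)%N.
Hypothesis s_even : ~~ odd s.

Let axis (j : 'I_N) : {ffun 'I_N -> nat} := [ffun i => if i == j then s else 0%N].

Let mideg_axis j : mideg (axis j) = s.
Proof.
rewrite /mideg (bigD1 j)//= ffunE eqxx big1 ?addn0// => i ij.
by rewrite ffunE (negbTE ij).
Qed.

Let monomial_axis j (v : 'rV[R]_N) : monomial (axis j) v = `|v 0 j| ^+ s.
Proof.
rewrite /monomial (bigD1 j)//= ffunE eqxx big1 ?mulr1 => [|i ij]; last first.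
  by rewrite ffunE (negbTE ij) expr0.
by rewrite -normrX ger0_norm// exprn_even_ge0.
Qed.

Let axis_moment (nu : moment_space s M) j :
  nu.-integrable [set: borel_rV R N] (EFin \o (fun v => `|v 0 j| ^+ s)) /\
  \int[nu]_v (`|v 0 j| ^+ s) = M (axis j).
Proof.
have [iv Ev] : has_moment nu (axis j) (M (axis j)).
  by apply: moment_probP; rewrite mideg_axis.
split; last first.
  by under eq_Rintegral do rewrite -monomial_axis; rewrite /Rintegral Ev.
rewrite [X in _.-integrable _ X](_ : _ = fun v : borel_rV R N => (monomial (axis j) v)%:E)//.
by apply/funext => v /=; rewrite monomial_axis.
Qed.

Lemma even_seq_complete : seq_complete (moment_space s M).
Proof.
move=> u cu.
have [U [UU ooU]] := ultraFilterLemma (eventually_filter).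
pose A := \sum_j M (axis j).
have A0 : 0 <= A.
  apply: sumr_ge0 => j _; rewrite -(axis_moment (u 0%N) j).2.
  by apply: Rintegral_ge0 => v _; exact: exprn_ge0.
have tight (e : R) : 0 < e -> exists K : R, forall n,
    (u n [set v | exists j, (K < `|v 0 j|)%R] <= e%:E)%E.
  (* K = A / e + 1 is at least 1, so K ^ s >= K and A / K ^ s <= A / K <= e. *)
  move=> e0; exists (A / e + 1) => n.
  have K1 : 1 <= A / e + 1 by rewrite lerDr divr_ge0// ltW.
  have K0 : 0 < A / e + 1 := lt_le_trans ltr01 K1.
  apply: le_trans (tail_le (s := s) (c := A) K0 _ _) _.
  - by move=> j; exact: (axis_moment (u n) j).1.
  - by rewrite le_eqVlt; apply/orP; left; apply/eqP/eq_bigr => j _; exact: (axis_moment (u n) j).2.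
  rewrite lee_fin ler_pdivrMr ?exprn_gt0//.
  apply: (@le_trans _ _ (e * (A / e + 1))).
    by rewrite mulrDr mulr1 mulrCA divff ?gt_eqF// mulr1 lerDl ltW.
  by rewrite ler_pM2l// ler_eXnr.
have [mu umu] := tight_ultralimit UU tight.
have imu j : mu.-integrable [set: borel_rV R N] (EFin \o (fun v => `|v 0 j| ^+ s)).
  apply: (@integrable_of_approximations _ _ _ mu (fun n => trunc_pow s n j) _ (M (axis j))).
  - by move=> n; exact: measurable_trunc_pow.
  - apply: measurable_funX; apply: measurableT_comp => //; exact: measurable_coord.
  - by move=> n v; case/andP: (trunc_pow_itv s n j v).
  - move=> v m n mn; rewrite lerXn2r ?nnegrE ?le_min ?normr_ge0 ?ler0n//.
    by rewrite !ge_min lexx/= ler_nat mn orbT.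
  - by move=> v; exact: trunc_pow_cvg.
  - move=> n; apply: (@bounded_integrable _ _ _ _ _ (n%:R ^+ s)).
      exact: measurable_trunc_pow.
    by move=> v; case/andP: (trunc_pow_itv s n j v) => ? ?; rewrite ger0_norm.
  (* The truncated power is at most |v_j| ^ s, whose integral under every [u m] is the same
     prescribed moment; the bound passes to the limit. *)
  - move=> n; have := umu _ (measurable_trunc_pow s n j) (n%:R ^+ s).
    move=> /(_ _ (trunc_pow_unif_continuous s n j)) h.
    apply: (cvgr_to_le (h _)).
      by move=> v; case/andP: (trunc_pow_itv s n j v) => ? ?; rewrite ger0_norm.
    apply: nearW => m; rewrite -(axis_moment (u m) j).2; apply: le_Rintegral => //.
    + apply: (@bounded_integrable _ _ _ _ _ (n%:R ^+ s)).
        exact: measurable_trunc_pow.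
      by move=> v; case/andP: (trunc_pow_itv s n j v) => ? ?; rewrite ger0_norm.
    + exact: (axis_moment (u m) j).1.
    + move=> v _; rewrite lerXn2r ?nnegrE ?le_min ?normr_ge0 ?ler0n//.
      by rewrite ge_min lexx.
have cos_cvg x : (fun n => \int[u n]_v cos (dotp x v)) @ U --> \int[mu]_v cos (dotp x v).
  apply: (umu _ (measurable_cos_dotp x) 1) => [v|]; first exact: cos_max.
  exact: dotp_unif_continuous norm_cosB_le.
have sin_cvg x : (fun n => \int[u n]_v sin (dotp x v)) @ U --> \int[mu]_v sin (dotp x v).
  apply: (umu _ (measurable_sin_dotp x) 1) => [v|]; first exact: sin_max.
  exact: dotp_unif_continuous norm_sinB_le.
have close (e : R) : 0 < e -> exists n0, forall n, (n0 <= n)%N -> forall x,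
    Normc.normc (fourier mu x - fourier (u n) x) <= e * enorm x ^+ s.
  move=> e0; have /cauchy_ballP/(_ e e0)[[B C] [[nB _ uB] [nC _ uC]] BC] := cu.
  exists (maxn nB nC) => n; rewrite geq_max => /andP[nBn nCn] x.
  have um m : (nC <= m)%N ->
      Normc.normc (fourier (u n) x - fourier (u m) x) <= e * enorm x ^+ s.
    move=> nCm; apply: normc_le_of_fdist => //.
    by apply: (BC (u n, u m)); split; [exact: uB|exact: uC].
  apply/ler_addgt0Pr => r r0; have r20 : 0 < r / 2 by rewrite divr_gt0.
  have /cvgrPdist_le/(_ _ r20) hc := cos_cvg x.
  have /cvgrPdist_le/(_ _ r20) hs := sin_cvg x.
  (* U contains all tails, so some m is both late and such that the transforms of [u m] and mu at
     this x are within r. This m depends on x, the resulting bound does not. *)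
  have hm : U [set m | (nC <= m)%N] by apply: ooU; exists nC.
  have [m [[hcm hsm] nCm]] := filter_ex (filterI (filterI hc hs) hm).
  apply: (le_trans (normc_distD _ (fourier (u m) x) _)); rewrite addrC lerD//.
    by rewrite normc_distC um.
  by rewrite (le_trans (normc_fourierB_le _ _ _))// [in leRHS](splitr r) lerD.
have mom b : (mideg b <= s)%N -> has_moment mu b (M b).
  apply: (has_moment_of_fourier s0) => [b' b's|e e0].
    exact: integrable_monomial b's imu.
  have [n0 h] := close _ e0; exists (u n0); split; last exact: h.
  by move=> b' b's; exact: moment_probP.
exists (MomentSpace mom); apply/cvg_ballP => e e0.
have e20 : 0 < e / 2 by rewrite divr_gt0.
have [n0 h] := close _ e20; exists n0 => // n /= n0n; rewrite /ball/= /fball/=.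
apply: (@le_lt_trans _ _ (e / 2)%:E); last by rewrite lte_fin ltr_pdivrMr// ltr_pMr// ltr1n.
by apply: fdist_le_of_normc => x _; exact: h.
Qed.

End even_complete.

(** * Odd order *)

Section dyadic_remainder.
Context {R : realType}.

(** Chosen bounded, with [ramp (2 * a) - ramp a] equal to 2 a / ((1 + 2 a) (1 + a)), which is
    comparable to min(a, 1 / a): the shape of the bounds on |[trem s.+1]| after division by a ^
    s. *)
Definition ramp (y : R) : R := 2 * y / (1 + y).

Lemma ramp_itv y : 0 <= y -> 0 <= ramp y <= 2.
Proof.
move=> y0; have y1 : 0 < 1 + y by rewrite ltr_pwDl.
apply/andP; split; first by rewrite divr_ge0 ?mulr_ge0// ltW.
by rewrite ler_pdivrMr// ler_pM2l// lerDr.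
Qed.

(* Summed over the dyadic multiples of y, the right-hand side telescopes. *)
Lemma norm_trem_le_ramp s (y : R) : (0 < s)%N ->
  `|trem s.+1 y| <= 6 * `|y| ^+ s * (ramp (2 * `|y|) - ramp `|y|).
Proof.
case: s => // k _; set a := `|y|.
have a0 : 0 <= a by exact: normr_ge0.
have E : ramp (2 * a) - ramp a = 2 * a / ((1 + 2 * a) * (1 + a)).
  by rewrite /ramp; field; apply/andP; split; rewrite gt_eqF//; lra.
have D0 : 0 < (1 + 2 * a) * (1 + a) by rewrite mulr_gt0//; lra.
have kf (j : nat) : a ^+ j / j`!%:R <= a ^+ j.
  by rewrite ler_piMr ?exprn_ge0// invf_le1 ?ltr0n ?fact_gt0// ler1n fact_gt0.
(* The remainder is at most a ^ (s + 1), used for a <= 1, and 2 a ^ (s - 1), used for a > 1. The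
   constant 6 comes from (1 + 2 a) (1 + a) <= 6 max(1, a ^ 2). *)
rewrite E mulrA ler_pdivlMr//; have [a1|a1] := leP a 1.
  apply: (@le_trans _ _ (a ^+ k.+2 * ((1 + 2 * a) * (1 + a)))).
    by rewrite ler_pM2r// (le_trans (norm_trem_le _ _)) ?kf.
  rewrite [leRHS](_ : _ = a ^+ k.+2 * 12); last by rewrite !exprS; ring.
  rewrite ler_wpM2l ?exprn_ge0//; nra.
apply: (@le_trans _ _ (2 * a ^+ k * ((1 + 2 * a) * (1 + a)))).
  by rewrite ler_pM2r// (le_trans (norm_tremS2_le _ _))// ler_pM2l// kf.
rewrite [leRHS](_ : _ = 2 * a ^+ k * (6 * a ^+ 2)); last by rewrite !exprS; ring.
rewrite ler_wpM2l ?mulr_ge0 ?exprn_ge0//; nra.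
Qed.

Lemma norm_trem_le_expr s (y : R) : (0 < s)%N -> `|trem s.+1 y| <= 12 * `|y| ^+ s.
Proof.
move=> s0; apply: (le_trans (norm_trem_le_ramp y s0)).
have /andP[h1 h2] := ramp_itv (normr_ge0 y).
have /andP[h3 h4] := ramp_itv (mulr_ge0 (ler0n R 2) (normr_ge0 y)).
rewrite [leRHS](_ : _ = 6 * `|y| ^+ s * 2); last by ring.
by rewrite ler_wpM2l ?mulr_ge0 ?exprn_ge0//; lra.
Qed.

End dyadic_remainder.

(** * Finitely supported probability measures *)

Section discrete_probability.
Context {R : realType} d (T : measurableType d).

Lemma discrete_probability_nat (K : nat) (c : nat -> R) (t : nat -> T) :
  (forall i, 0 <= c i) -> \sum_(i < K) c i = 1 ->
  exists nu : probability T R, forall f : T -> R, measurable_fun setT f ->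
    nu.-integrable setT (EFin \o f) /\ \int[nu]_x f x = \sum_(i < K) c i * f (t i).
Proof.
move=> c0 c1.
pose m i : {measure set T -> \bar R} := mscale (NngNum (c0 i)) (\d_(t i)).
pose nu : {measure set T -> \bar R} := msum m K.
have int_nu (f : T -> \bar R) : measurable_fun setT f -> (forall x, (0 <= f x)%E) ->
    (\int[nu]_x f x = \sum_(i < K) ((c i)%:E * f (t i)))%E.
  move=> mf f0; rewrite ge0_integral_measure_sum//; apply: eq_bigr => i _.
  by rewrite ge0_integral_mscale// integral_dirac// diracT mul1e.
have nuT : nu setT = 1%E.
  rewrite -[LHS]mul1e -integral_cst// int_nu//.
  transitivity (\sum_(i < K) c i)%:E; last by rewrite c1.
  by rewrite -sumEFin; apply: eq_bigr => i _; rewrite mule1.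
(* The mass is already 1; normalising only provides the structure of a probability. *)
pose P : probability T R := mnormalize nu \d_(t 0%N).
have int_ge0 (f : T -> \bar R) : measurable_fun setT f -> (forall x, (0 <= f x)%E) ->
    (\int[P]_x f x = \sum_(i < K) ((c i)%:E * f (t i)))%E.
  move=> mf f0; rewrite -int_nu//; apply: eq_measure_integral => A mA _.
  rewrite /P /= /mnormalize [X in if X then _ else _](_ : _ = false).
    by rewrite [X in fine X]nuT invr1 mule1.
  by rewrite [X in X == 0%E]nuT [X in X == +oo%E]nuT onee_eq0.
exists P => f mf; have mfe : measurable_fun setT (EFin \o f) by exact/measurable_EFinP.
split.
  apply/integrableP; split => //.
  rewrite [X in (X < _)%E]int_ge0//; last exact: measurableT_comp.
  rewrite (eq_bigr (fun i : 'I_K => (c i * `|f (t i)|)%:E)) => [|i _]; last by rewrite EFinM.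
  by rewrite sumEFin ltry.
rewrite /Rintegral [X in fine X]integralE.
rewrite [X in (X - _)%E]int_ge0//; last exact: measurable_funepos.
rewrite [X in (_ - X)%E]int_ge0//; last exact: measurable_funeneg.
rewrite (eq_bigr (fun i : 'I_K => (c i * Num.max (f (t i)) 0)%:E)); last first.
  by move=> i _; rewrite funeposE /= -EFin_max -EFinM.
rewrite [X in (_ - X)%E](eq_bigr (fun i : 'I_K => (c i * Num.max (- f (t i)) 0)%:E)); last first.
  by move=> i _; rewrite funenegE /= -EFin_max -EFinM.
rewrite !sumEFin -EFinB /= -sumrB; apply: eq_bigr => i _.
by rewrite -mulrBr; congr (_ * _); rewrite /Num.max; case: ltP => ?; case: ltP => ?; lra.
Qed.

Lemma discrete_probability (I : finType) (c : I -> R) (t : I -> T) :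
  (forall i, 0 <= c i) -> \sum_i c i = 1 ->
  exists nu : probability T R, forall f : T -> R, measurable_fun setT f ->
    nu.-integrable setT (EFin \o f) /\ \int[nu]_x f x = \sum_i c i * f (t i).
Proof.
move=> c0 c1.
have [i0] : exists i : I, true.
  apply: contrapT => noI; move: c1; rewrite big1 => [/eqP|i _]; last by case: noI; exists i.
  by rewrite eq_sym oner_eq0.
move=> _; pose e k : I := nth i0 (enum I) k.
have sumE (g : I -> R) : \sum_(k < #|I|) g (e k) = \sum_i g i.
  rewrite -[RHS]big_enum /= (big_nth i0) -cardE big_mkord; exact: eq_bigr.
have [nu nuf] := @discrete_probability_nat #|I| (c \o e) (t \o e) (fun k => c0 _)
  (etrans (sumE c) c1).
exists nu => f mf; have [? ->] := nuf f mf; split=> //.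
exact: (sumE (fun i => c i * f (t i))).
Qed.

End discrete_probability.

(** * Interpolation of even powers *)

Section even_interpolation.
Context {R : realType} (m : nat).

Definition node (i : 'I_m.+1) : R := i.+1%:R.

(** For even powers up to 2m, a unit mass at t is equivalent to the signed masses [c t i] at the
    nodes. They solve a Vandermonde system in the squares of the nodes, which are distinct. The
    right-hand side has entries at most t ^ (2m) for t >= 1, and so do the solutions up to a
    constant. *)
Lemma interpolation : exists (C : R) (c : R -> 'I_m.+1 -> R), [/\ 0 < C,
  forall t j, (j <= m)%N -> \sum_i c t i * node i ^+ j.*2 = t ^+ j.*2 &
  forall t i, 1 <= t -> `|c t i| <= C * t ^+ m.*2].
Proof.
pose a : 'rV[R]_m.+1 := \row_i node i ^+ 2.
pose V := Vandermonde m.+1 a.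
have uV : V \in unitmx.
  rewrite unitmxE det_Vandermonde unitfE; apply/prodf_neq0 => i _.
  apply/prodf_neq0 => j ij; rewrite !mxE subr_eq0 eqrXn2 ?ler0n// eqr_nat eqSS.
  by rewrite gtn_eqF.
pose W := invmx V.
pose p (t : R) : 'cV[R]_m.+1 := \col_j t ^+ (j : nat).*2.
exists (1 + \sum_i \sum_j `|W i j|), (fun t i => (W *m p t) i 0); split.
- rewrite ltr_pwDl// sumr_ge0// => i _; rewrite sumr_ge0//.
- move=> t j jm; have jm1 : (j < m.+1)%N by [].
  have /(congr1 (fun A : 'cV[R]_m.+1 => A (Ordinal jm1) 0)) : V *m (W *m p t) = p t.
    by rewrite mulmxA mulmxV// mul1mx.
  rewrite !mxE /= => <-; apply: eq_bigr => i _.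
  by rewrite !mxE /= mulrC -exprM mul2n.
- move=> t i t1; rewrite mxE (le_trans (ler_norm_sum _ _ _))//.
  apply: (@le_trans _ _ (\sum_j `|W i j| * t ^+ m.*2)).
    apply: ler_sum => j _; rewrite normrM ler_wpM2l// mxE normrX ger0_norm ?(le_trans ler01)//.
    by rewrite ler_weXn2l// leq_double -ltnS.
  rewrite -mulr_suml ler_wpM2r ?exprn_ge0 ?(le_trans ler01)//.
  rewrite [X in _ + X](bigD1 i)//= addrCA lerDl addr_ge0// sumr_ge0// => k _.
  by rewrite sumr_ge0.
Qed.

End even_interpolation.

(** * A Cauchy sequence without limit for odd order *)

Section axis_measures.
Context {R : realType} (N' m : nat).
Local Notation N := N'.+1.
Local Notation s := m.*2.+1.
Variables (C : R) (c : R -> 'I_m.+1 -> R).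
Hypothesis C0 : 0 < C.
Hypothesis c_exact : forall t j, (j <= m)%N ->
  \sum_i c t i * node i ^+ j.*2 = t ^+ j.*2.
Hypothesis c_le : forall t i, 1 <= t -> `|c t i| <= C * t ^+ m.*2.

Definition axis_pt (t : R) : 'rV[R]_N := \row_i (if i == ord0 then t else 0).

Lemma dotp_axis_ptl y (v : 'rV[R]_N) : dotp (axis_pt y) v = y * v 0 ord0.
Proof.
rewrite /dotp (bigD1 ord0)//= mxE eqxx big1 ?addr0// => i i0.
by rewrite mxE (negbTE i0) mul0r.
Qed.

Lemma dotp_axis_ptr x t : dotp x (axis_pt t) = x 0 ord0 * t.
Proof.
rewrite /dotp (bigD1 ord0)//= mxE eqxx big1 ?addr0// => i i0.
by rewrite mxE (negbTE i0) mulr0.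
Qed.

Lemma enorm_axis_pt y : enorm (axis_pt y) = `|y|.
Proof.
rewrite /enorm (bigD1 ord0)//= mxE eqxx big1 ?addr0 ?sqrtr_sqr// => i i0.
by rewrite mxE (negbTE i0) expr0n.
Qed.

Lemma norm_coord_le_enorm (x : 'rV[R]_N) : `|x 0 ord0| <= enorm x.
Proof.
rewrite -sqrtr_sqr ler_wsqrtr// (bigD1 ord0)//= lerDl sumr_ge0// => i _.
exact: sqr_ge0.
Qed.

(** As 0 ^ 0 = 1, this is 1 when b is supported on the first coordinate and 0 otherwise. *)
Let off_axis (b : {ffun 'I_N -> nat}) : R := \prod_(i < N | i != ord0) 0 ^+ b i.

Lemma monomial_axis_pt b t : monomial b (axis_pt t) = off_axis b * t ^+ b ord0.
Proof.
rewrite /monomial (bigD1 ord0)//= mxE eqxx mulrC; congr (_ * _).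
by apply: eq_bigr => i i0; rewrite mxE (negbTE i0).
Qed.

(* This choice makes the corrections at a node sum to at most half of the initial
   weight 1 / (m + 1). *)
Let eps : R := (4 * C * m.+1%:R)^-1.

Let eps0 : 0 < eps.
Proof. by rewrite invr_gt0 !mulr_gt0. Qed.

Let weight (k : nat) : R := eps / k.+1%:R / (2 ^+ k) ^+ s.

Let weight_ge0 k : 0 <= weight k.
Proof. by rewrite !divr_ge0 ?ltW// !exprn_ge0. Qed.

Let weight_scaled k : (2 ^+ k) ^+ s * weight k = eps / k.+1%:R.
Proof. by rewrite /weight mulrC divfK// expf_neq0// expf_neq0. Qed.

(** The mass remaining at +- [node i] once each of the first n added masses has been balanced by
    subtracting its interpolation weights. *)
Let correction (n : nat) (i : 'I_m.+1) : R :=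
  m.+1%:R^-1 - \sum_(k < n) weight k * c (2 ^+ k) i.

(** The order s = 2m + 1 exceeds the growth exponent 2m of c by one, which leaves the summable
    factor 2 ^ (- k). *)
Let weight_c_le k i : weight k * `|c (2 ^+ k) i| <= eps * C / k.+1%:R / 2 ^+ k.
Proof.
have t1 : 1 <= 2 ^+ k :> R by rewrite exprn_ege1// ler1n.
have t0 : 0 < 2 ^+ k :> R := lt_le_trans ltr01 t1.
apply: le_trans (ler_wpM2l (weight_ge0 k) (c_le i t1)) _.
rewrite le_eqVlt; apply/orP; left; apply/eqP; rewrite /weight exprS.
by field; rewrite nat1r pnatr_eq0 !expf_neq0.
Qed.

Let correction_ge0 n i : 0 <= correction n i.
Proof.
rewrite subr_ge0; apply: (@le_trans _ _ (\sum_(k < n) eps * C / 2 ^+ k)).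
  apply: ler_sum => k _; apply: le_trans (ler_norm _) _.
  rewrite normrM (ger0_norm (weight_ge0 _)) (le_trans (weight_c_le _ _))//.
  rewrite ler_wpM2r ?invr_ge0 ?exprn_ge0// ler_pdivrMr// ler_peMr ?ler1n//.
  by rewrite mulr_ge0// ltW.
suff : \sum_(k < n) eps * C / 2 ^+ k = 2 * (eps * C) * (1 - (2 ^+ n)^-1).
  move=> ->; apply: (@le_trans _ _ (2 * (eps * C))).
    by rewrite ler_piMr ?mulr_ge0 ?ltW// lerBlDr lerDl invr_ge0 exprn_ge0.
  rewrite /eps (_ : 2 * _ = m.+1%:R^-1 / 2); last by field; rewrite nat1r pnatr_eq0 (gt_eqF C0).
  by rewrite ler_pdivrMr// ler_peMr ?ler1n// invr_ge0.
elim: n => [|n IH]; first by rewrite big_ord0 expr0 invr1 subrr mulr0.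
rewrite big_ord_recr/= IH exprS; field.
by rewrite expf_neq0.
Qed.

Definition even_part (g : R -> R) (t : R) : R := (g t + g (- t)) / 2.

(** Expectation under the n-th measure, in which every mass is shared equally between a point and
    its opposite. *)
Let expect (n : nat) (g : R -> R) : R :=
  \sum_i correction n i * even_part g (node i) +
  \sum_(k < n) weight k * even_part g (2 ^+ k).

Let increment (k : nat) (g : R -> R) : R :=
  even_part g (2 ^+ k) - \sum_i c (2 ^+ k) i * even_part g (node i).

Let expectS n g : expect n.+1 g - expect n g = weight n * increment n g.
Proof.
rewrite /expect [X in _ + X - _]big_ord_recr/= /increment mulrBr mulr_sumr.
rewrite (eq_bigr (fun i => correction n i * even_part g (node i) -
    weight n * (c (2 ^+ n) i * even_part g (node i)))); last first.
  by move=> i _; rewrite /correction big_ord_recr/=; ring.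
by rewrite sumrB; ring.
Qed.

Let expect_diff n p g : (n <= p)%N ->
  expect p g - expect n g = \sum_(n <= k < p) weight k * increment k g.
Proof.
move=> np; rewrite -(telescope_sumr (expect ^~ g))//.
by apply: eq_bigr => k _; rewrite expectS.
Qed.

(** Odd powers, among them the power s, vanish by symmetry; even powers have exponent at most 2m and
    are interpolated exactly. *)
Let increment_expr k j : (j <= s)%N -> increment k (fun t => t ^+ j) = 0.
Proof.
have [oj _|ej js] := boolP (odd j).
  have ep t : even_part (fun t => t ^+ j) t = 0.
    by rewrite /even_part exprNn -signr_odd oj expr1 mulN1r subrr mul0r.
  by rewrite /increment ep big1 ?subrr// => i _; rewrite ep mulr0.
have ep t : even_part (fun t => t ^+ j) t = t ^+ (j./2).*2.
  by rewrite /even_part exprNn -signr_odd (negbTE ej) expr0 mul1r even_halfK//; field.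
rewrite /increment ep (eq_bigr (fun i => c (2 ^+ k) i * node i ^+ (j./2).*2)) => [|i _]; last first.
  by rewrite ep.
rewrite c_exact ?subrr// -leq_double even_halfK//.
by move: js; rewrite leq_eqVlt => /predU1P[jE|//]; move: ej; rewrite jE /= odd_double.
Qed.

Let expect_expr n j : (j <= s)%N -> expect n (fun t => t ^+ j) = expect 0 (fun t => t ^+ j).
Proof.
move=> js; apply/eqP; rewrite -subr_eq0 expect_diff// big1// => k _.
by rewrite increment_expr// mulr0.
Qed.

Let expect_cst n : expect n (fun=> 1) = 1.
Proof.
have -> : (fun=> 1) = (fun t : R => t ^+ 0) by apply/funext => t; rewrite expr0.
rewrite expect_expr// /expect big_ord0 addr0.
have -> : (fun t : R => t ^+ 0) = (fun=> 1) by apply/funext => t; rewrite expr0.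
rewrite (eq_bigr (fun=> m.+1%:R^-1)) => [|i _]; last first.
  by rewrite /correction big_ord0 /even_part; field; rewrite nat1r pnatr_eq0.
by rewrite sumr_const card_ord -[LHS]mulr_natl mulfV// pnatr_eq0.
Qed.

Let expect0_expr_ge0 j : 0 <= expect 0 (fun t => t ^+ j).
Proof.
rewrite /expect big_ord0 addr0 sumr_ge0// => i _; rewrite mulr_ge0 ?correction_ge0//.
have nj : 0 <= node i ^+ j :> R by rewrite exprn_ge0// ler0n.
rewrite divr_ge0// exprNn -signr_odd; case: (odd j); first by rewrite expr1 mulN1r subrr.
by rewrite expr0 mul1r addr_ge0.
Qed.

Let axis_probability n : exists nu : probability (borel_rV R N) R,
  forall f : 'rV[R]_N -> R, measurable_fun [set: borel_rV R N] f ->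
    nu.-integrable [set: borel_rV R N] (EFin \o f) /\
    \int[nu]_v f v = expect n (f \o axis_pt).
Proof.
pose I := (bool * ('I_m.+1 + 'I_n))%type.
pose wt (i : I) : R := (match i.2 with inl j => correction n j | inr k => weight k end) / 2.
pose pos (i : I) : R := (if i.1 then 1 else -1) *
  (match i.2 with inl j => node j | inr k => 2 ^+ k end).
have sumE (g : R -> R) : \sum_i wt i * g (pos i) = expect n g.
  rewrite (eq_bigr (fun i => wt (i.1, i.2) * g (pos (i.1, i.2)))); last by move=> [].
  rewrite -(pair_big xpredT xpredT (fun b x => wt (b, x) * g (pos (b, x))))/=.
  rewrite big_bool /= !big_sumType /= /wt /pos /= addrACA -!big_split /= /expect.
  by congr (_ + _); apply: eq_bigr => i _; rewrite /even_part !mul1r !mulN1r; field.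
have [i||nu nuf] := @discrete_probability R _ (borel_rV R N) I wt (fun i => axis_pt (pos i)).
- by rewrite divr_ge0//; case: i => b [j|k] /=; rewrite ?correction_ge0 ?weight_ge0.
- by rewrite -(expect_cst n) -sumE; apply: eq_bigr => i _; rewrite mulr1.
exists nu => f mf; have [? ->] := nuf f mf; split => //.
by rewrite -sumE.
Qed.

Let s_even : odd s.+1 = false.
Proof. by rewrite /= negbK odd_double. Qed.

(** The order s + 1 is even, so this function is even and nonnegative. Up to sign it differs from
    cos (y t) by a polynomial of degree less than s in t, so it separates two measures of the space
    exactly as much as the cosine does. *)
Let probe (y t : R) : R := trem s.+1 (y * t).

Let even_part_probe y t : even_part (probe y) t = probe y t.
Proof.
by rewrite /even_part /probe mulrN tremN -signr_odd s_even expr0 mul1r; field.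
Qed.

(** There are m + 1 nodes, each at most m + 1; 12 is the constant of [norm_trem_le_expr] and
    [eps * C] that of [weight_c_le]. *)
Let gamma : R := 12 * m.+1%:R * m.+1%:R ^+ s * (eps * C).

Let gamma0 : 0 <= gamma.
Proof. by rewrite !mulr_ge0 ?exprn_ge0// ltW. Qed.

(** Its increment in k is 6 eps times that of the ramp, for the new mass at scale 2 ^ k, plus gamma
    / 2 ^ k, for the compensation at the nodes. It is bounded uniformly in y and k. *)
Let potential (y : R) (k : nat) : R := 6 * eps * ramp (`|y| * 2 ^+ k) - 2 * gamma / 2 ^+ k.

Let weight_increment_le k y : `|weight k * increment k (probe y)| <=
  k.+1%:R^-1 * (`|y| ^+ s * (potential y k.+1 - potential y k)).
Proof.
have t0 : 0 < 2 ^+ k :> R by rewrite exprn_gt0.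
rewrite normrM (ger0_norm (weight_ge0 k)) /increment even_part_probe.
have atom_le : weight k * `|probe y (2 ^+ k)| <=
    k.+1%:R^-1 * (`|y| ^+ s * (6 * eps * (ramp (`|y| * 2 ^+ k.+1) - ramp (`|y| * 2 ^+ k)))).
  apply: le_trans (ler_wpM2l (weight_ge0 k) (norm_trem_le_ramp _ (ltn0Sn _))) _.
  rewrite normrM (gtr0_norm t0) exprMn mulrCA [2 * _]mulrCA -exprS.
  rewrite le_eqVlt; apply/orP; left; apply/eqP.
  transitivity (6 * `|y| ^+ s * ((2 ^+ k) ^+ s * weight k) *
    (ramp (`|y| * 2 ^+ k.+1) - ramp (`|y| * 2 ^+ k))); first by ring.
  by rewrite weight_scaled; field; rewrite nat1r pnatr_eq0.
have nodes_le : weight k * `|\sum_i c (2 ^+ k) i * even_part (probe y) (node i)| <=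
    k.+1%:R^-1 * (`|y| ^+ s * (gamma / 2 ^+ k)).
  apply: (@le_trans _ _ (\sum_(i < m.+1) eps * C / k.+1%:R / 2 ^+ k * (12 * (`|y| ^+ s * m.+1%:R ^+ s)))).
    apply: le_trans (ler_wpM2l (weight_ge0 k) (ler_norm_sum _ _ _)) _.
    rewrite mulr_sumr; apply: ler_sum => i _; rewrite normrM mulrA.
    apply: ler_pM => //; first exact: mulr_ge0.
    rewrite even_part_probe (le_trans (norm_trem_le_expr _ _))// ler_pM2l//.
    rewrite normrM exprMn ler_wpM2l ?exprn_ge0// lerXn2r ?nnegrE ?ler0n//.
    by rewrite /node normr_nat ler_nat ltn_ord.
  rewrite sumr_const card_ord -[leLHS]mulr_natl le_eqVlt; apply/orP; left; apply/eqP.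
  by rewrite /gamma; field; rewrite nat1r pnatr_eq0 gt_eqF.
apply: le_trans (ler_wpM2l (weight_ge0 k) (ler_normB _ _)) _.
rewrite mulrDr; apply: le_trans (lerD atom_le nodes_le) _.
rewrite -!mulrDr le_eqVlt; apply/orP; left; apply/eqP; congr (_ * (_ * _)).
by rewrite /potential exprS; field; rewrite gt_eqF.
Qed.

Let bound : R := 12 * eps + 2 * gamma.

Let bound0 : 0 <= bound.
Proof. by rewrite addr_ge0 ?mulr_ge0// ltW. Qed.

(** The factors 1 / (k + 1) are not summable, but for fixed y they multiply nonnegative increments
    of a bounded potential: the largest one, 1 / (n + 1), comes out and the rest telescopes to at
    most [bound]. *)
Let expect_probe_le n p y : (n <= p)%N ->
  `|expect p (probe y) - expect n (probe y)| <= bound / n.+1%:R * `|y| ^+ s.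
Proof.
move=> np; rewrite expect_diff// (le_trans (ler_norm_sum _ _ _))//.
apply: (@le_trans _ _ (\sum_(n <= k < p)
    n.+1%:R^-1 * (`|y| ^+ s * (potential y k.+1 - potential y k)))).
  rewrite big_nat_cond [leRHS]big_nat_cond; apply: ler_sum => k /andP[/andP[nk _] _].
  rewrite (le_trans (weight_increment_le _ _))// ler_wpM2r//.
    rewrite mulr_ge0 ?exprn_ge0//.
    (* The increment of the potential is nonnegative since its product with |y| ^ s / (k + 1) bounds
       an absolute value. At y = 0 this factor vanishes and the increment is computed directly. *)
    have := le_trans (normr_ge0 _) (weight_increment_le k y).
    have [->|y0] := eqVneq y 0.
      move=> _; rewrite /potential normr0 !mul0r exprS invfM.
      have : 0 <= 2 * gamma / 2 ^+ k by apply: divr_ge0 => //; exact: mulr_ge0.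
      by move=> ?; lra.
    by rewrite pmulr_rge0 ?invr_gt0// pmulr_rge0// exprn_gt0// normr_gt0.
  by rewrite lef_pV2 ?posrE ?ltr0n// ler_nat ltnS.
rewrite -!mulr_sumr telescope_sumr//.
rewrite [leRHS](_ : _ = n.+1%:R^-1 * (`|y| ^+ s * bound)); last by ring.
rewrite ler_wpM2l ?invr_ge0// ler_wpM2l ?exprn_ge0//.
have /andP[r0 r2] : 0 <= ramp (`|y| * 2 ^+ p) <= 2 by rewrite ramp_itv ?mulr_ge0 ?exprn_ge0.
have /andP[r3 r4] : 0 <= ramp (`|y| * 2 ^+ n) <= 2 by rewrite ramp_itv ?mulr_ge0 ?exprn_ge0.
have g1 : 0 <= 2 * gamma / 2 ^+ p by apply: divr_ge0 => //; exact: mulr_ge0.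
have g2 : 2 * gamma / 2 ^+ n <= 2 * gamma.
  by rewrite ler_pdivrMr ?exprn_gt0// ler_peMr ?exprn_ege1 ?ler1n//; exact: mulr_ge0.
have e1 : 6 * eps * ramp (`|y| * 2 ^+ p) <= 12 * eps.
  by rewrite (_ : 12 * eps = 6 * eps * 2); [rewrite ler_pM2l ?mulr_gt0|ring].
have e2 : 0 <= 6 * eps * ramp (`|y| * 2 ^+ n) by rewrite !mulr_ge0// ltW.
by rewrite /potential /bound; lra.
Qed.

(** Taken from the initial law; [expect_expr] makes these moments common to all n. *)
Let moment (b : {ffun 'I_N -> nat}) : R := off_axis b * expect 0 (fun t => t ^+ b ord0).

Let moment_ge0 b : 0 <= moment b.
Proof.
apply: mulr_ge0; last exact: expect0_expr_ge0.
by apply: prodr_ge0 => i _; exact: exprn_ge0.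
Qed.

Let axis_moment_space n : exists nu : moment_space s moment,
  forall f : 'rV[R]_N -> R, measurable_fun [set: borel_rV R N] f ->
    nu.-integrable [set: borel_rV R N] (EFin \o f) /\
    \int[nu]_v f v = expect n (f \o axis_pt).
Proof.
have [nu nuf] := axis_probability n.
have mom b : (mideg b <= s)%N -> has_moment nu b (moment b).
  move=> bs; have [ib Eb] := nuf _ (measurable_monomial b); split => //.
  rewrite -[LHS]fineK; last exact: integrable_fin_num.
  congr EFin; rewrite [LHS]Eb /moment -(expect_expr n); last first.
    by rewrite (leq_trans _ bs)// /mideg (bigD1 ord0)//= leq_addr.
  have -> : monomial b \o axis_pt = fun t => off_axis b * t ^+ b ord0.
    by apply/funext => t /=; rewrite monomial_axis_pt.
  rewrite /expect mulrDr !mulr_sumr; congr (_ + _); apply: eq_bigr => i _;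
    by rewrite /even_part; ring.
by exists (MomentSpace mom).
Qed.


Let coord (v : borel_rV R N) : R := v 0 ord0.

Let integrable_coordX (nu : moment_space s moment) k : (k <= s)%N ->
  nu.-integrable setT (EFin \o (fun v => coord v ^+ k)) /\
  \int[nu]_v (coord v ^+ k) = moment [ffun i => if i == ord0 then k else 0%N].
Proof.
move=> ks; set b := [ffun _ => _].
have bk : mideg b = k.
  rewrite /mideg (bigD1 ord0)//= ffunE eqxx big1 ?addn0// => i i0.
  by rewrite ffunE (negbTE i0).
have monoE : monomial b = fun v : 'rV[R]_N => v 0 ord0 ^+ k.
  apply/funext => v; rewrite /monomial (bigD1 ord0)//= ffunE eqxx big1 ?mulr1// => i i0.
  by rewrite ffunE (negbTE i0) expr0.
have [ib Eb] : has_moment nu b (moment b) by apply: moment_probP; rewrite bk.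
by rewrite monoE in ib Eb; split => //; rewrite /Rintegral Eb.
Qed.

Let probe_gap (nu1 nu2 : moment_space s moment) y :
  `|\int[nu1]_v probe y (coord v) - \int[nu2]_v probe y (coord v)| =
  `|\int[nu1]_v cos (y * coord v) - \int[nu2]_v cos (y * coord v)|.
Proof.
have mc : measurable_fun [set: borel_rV R N] coord := measurable_coord ord0.
rewrite /probe (@norm_trem_gap R _ _ nu1 _ _ nu2 coord coord s) ?s_even//.
- by move=> k /(integrable_coordX nu1)[].
- by move=> k /(integrable_coordX nu2)[].
- move=> j /ltnW; rewrite ltnS => js.
  by rewrite (integrable_coordX nu1 js).2 (integrable_coordX nu2 js).2.
Qed.

Section sequence.
Variable u : nat -> moment_space s moment.
Hypothesis uE : forall n f, measurable_fun [set: borel_rV R N] f ->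
    (u n).-integrable [set: borel_rV R N] (EFin \o f) /\
    \int[u n]_v f v = expect n (f \o axis_pt).

Let measurable_probe y : measurable_fun [set: borel_rV R N] (fun v => probe y (coord v)).
Proof. exact: measurable_trem (measurable_coord ord0) _ _. Qed.

Let uE_probe n y : \int[u n]_v probe y (coord v) = expect n (probe y).
Proof.
rewrite (uE n (measurable_probe y)).2; congr (expect n _).
by apply/funext => t /=; rewrite /coord mxE eqxx.
Qed.

Let uE_cos n x : \int[u n]_v cos (dotp x v) = \int[u n]_v cos (x 0 ord0 * coord v).
Proof.
have mc : measurable_fun [set: borel_rV R N] (fun v => cos (x 0 ord0 * coord v)).
  exact: (measurable_trem (measurable_coord ord0) 0 _).
rewrite (uE n (measurable_cos_dotp x)).2 (uE n mc).2; congr (expect n _).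
by apply/funext => t /=; rewrite dotp_axis_ptr /coord mxE eqxx.
Qed.

Let uE_sin n x : \int[u n]_v sin (dotp x v) = 0.
Proof.
rewrite (uE n (measurable_sin_dotp x)).2 /expect.
have odd0 t : even_part ((fun v => sin (dotp x v)) \o axis_pt) t = 0.
  by rewrite /even_part /= !dotp_axis_ptr mulrN sinN subrr mul0r.
rewrite !big1 ?addr0// => i _; by rewrite odd0 mulr0.
Qed.

(** The sine parts vanish by symmetry, and only the first coordinate of x matters, which is at most
    |x|. *)
Let fdist_u_le n p : (n <= p)%N -> (fdist s (u p) (u n) <= (bound / n.+1%:R)%:E)%E.
Proof.
move=> np; apply: fdist_le_of_normc => x _.
rewrite (le_trans (normc_fourierB_le _ _ _))// !uE_sin subrr normr0 addr0 !uE_cos.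
rewrite -probe_gap !uE_probe (le_trans (expect_probe_le _ np))//.
rewrite ler_wpM2l ?divr_ge0// lerXn2r ?nnegrE ?sqrtr_ge0//.
exact: norm_coord_le_enorm.
Qed.

Lemma axis_sequence_cauchy : cauchy (u @ \oo).
Proof.
apply: cauchy_exP => e e0; pose n := Num.truncn (bound / e).
have ne : bound / n.+1%:R < e.
  by rewrite ltr_pdivrMr ?ltr0n// mulrC -ltr_pdivrMr// truncnS_gt.
exists (u n); exists n => // p /= np; rewrite /ball/= /fball/= fdistC.
by rewrite (le_lt_trans (fdist_u_le np))// lte_fin.
Qed.

(** All terms are nonnegative, and the frequency 2 ^ (- j) brings the mass at +- 2 ^ j to the
    arguments +- 1, where the probe equals [trem s.+1 1]. *)
Let expect_probe_ge j n : (j < n)%N ->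
  weight j * trem s.+1 1 <= expect n (probe (2 ^+ j)^-1).
Proof.
move=> jn; have probe_ge0 t : 0 <= even_part (probe (2 ^+ j)^-1) t.
  by rewrite even_part_probe /probe trem_even_ge0//= odd_double.
rewrite /expect (bigD1 (Ordinal jn) (P := xpredT))//= even_part_probe.
have -> : probe (2 ^+ j)^-1 (2 ^+ j) = trem s.+1 1 by rewrite /probe mulVf ?expf_neq0.
rewrite addrCA lerDl addr_ge0// sumr_ge0// => i _.
  by rewrite mulr_ge0 ?correction_ge0.
by rewrite mulr_ge0 ?weight_ge0.
Qed.

Variable l : moment_space s moment.
Hypothesis ul : u @ \oo --> l.

(** Convergence is used at the single frequency 2 ^ (- j), where |y| ^ s <= 1. *)
Let limit_probe_ge j : weight j * trem s.+1 1 <= \int[l]_v probe (2 ^+ j)^-1 (coord v).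
Proof.
apply/ler_addgt0Pr => e e0; move/cvg_ballP : ul => /(_ e e0) [n0 _ hn].
pose n := maxn n0 j.+1; pose y : R := (2 ^+ j)^-1.
have jn : (j < n)%N by rewrite leq_maxr.
have y1 : `|y| <= 1.
  by rewrite normfV ger0_norm ?exprn_ge0// invf_le1 ?exprn_gt0// exprn_ege1// ler1n.
have := hn n (leq_maxl _ _); rewrite /ball/= /fball/= => /(normc_le_of_fdist e0).
move=> /(_ (axis_pt y)) /(le_trans (norm_cosB_le_normc _ _ _)).
under eq_Rintegral do rewrite dotp_axis_ptl.
under [X in `|_ - X|]eq_Rintegral do rewrite dotp_axis_ptl.
rewrite -[X in X <= _](probe_gap l (u n)) uE_probe enorm_axis_pt => ln.
apply: le_trans (expect_probe_ge jn) _; rewrite -lerBlDl.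
rewrite (le_trans (ler_norm _))// distrC (le_trans ln)//.
by apply: ler_piMr; [exact: ltW|exact: exprn_ile1].
Qed.

(** Probes of frequency 2 ^ (- j), scaled by 2 ^ (j s), are nonnegative with expectation at least
    [eps * trem s.+1 1] / (j + 1) under l. By [norm_trem_le_ramp] their sum over j telescopes to at
    most 12 times the s-th absolute power of the first coordinate, integrable under l because the
    moment of order s exists; the lower bounds, however, have a divergent sum. *)
Lemma axis_sequence_no_limit : False.
Proof.
have il : l.-integrable setT (EFin \o (fun v => 12 * `|coord v| ^+ s)).
  apply: integrable_mulr => //.
  have := integrable_norm (integrable_coordX l (leqnn s)).1.
  by apply: eq_integrable => // v _ /=; rewrite normrX.
have E12 v : 12 * `|coord v| ^+ s = 6 * `|coord v| ^+ s * 2 by ring.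
pose scaled (j : nat) v := (2 ^+ j) ^+ s * probe (2 ^+ j)^-1 (coord v).
have scaled_ge0 j v : 0 <= scaled j v.
  by rewrite mulr_ge0 ?exprn_ge0// trem_even_ge0//= odd_double.
have scaled_le j v : scaled j v <=
    6 * `|coord v| ^+ s * (ramp (2 * (`|coord v| / 2 ^+ j)) - ramp (2 * (`|coord v| / 2 ^+ j.+1))).
  have t0 : 0 < 2 ^+ j :> R by rewrite exprn_gt0.
  rewrite -(ger0_norm (scaled_ge0 j v)) normrM (ger0_norm (exprn_ge0 _ (ltW t0))).
  apply: le_trans (ler_wpM2l (exprn_ge0 _ (ltW t0)) (norm_trem_le_ramp _ (ltn0Sn _))) _.
  rewrite normrM normfV (gtr0_norm t0) [_^-1 * _]mulrC.
  rewrite [2 * (_ / 2 ^+ j.+1)](_ : _ = `|coord v| / 2 ^+ j); last first.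
    by rewrite exprS; field; rewrite gt_eqF.
  rewrite exprMn exprVn le_eqVlt; apply/orP; left; apply/eqP.
  by field; rewrite expf_neq0// gt_eqF.
have ramp01 j v : 0 <= ramp (2 * (`|coord v| / 2 ^+ j)) <= 2.
  by rewrite ramp_itv// !mulr_ge0 ?invr_ge0 ?exprn_ge0.
have iscaled j : l.-integrable setT (EFin \o scaled j).
  apply: le_integrable il => //.
    by apply/measurable_EFinP; apply: measurable_funM => //; exact: measurable_probe.
  move=> v _ /=; rewrite lee_fin (ger0_norm (scaled_ge0 j v)).
  apply: le_trans (ler_norm _).
  have /andP[r1 r2] := ramp01 j v; have /andP[r3 r4] := ramp01 j.+1 v.
  rewrite (le_trans (scaled_le j v))// E12.
  by rewrite ler_wpM2l ?mulr_ge0 ?exprn_ge0//; lra.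
pose K := \int[l]_v (12 * `|coord v| ^+ s).
have sum_le J : \sum_(j < J) eps * trem s.+1 1 / j.+1%:R <= K.
  apply: (@le_trans _ _ (\sum_(j < J) \int[l]_v scaled j v)).
    apply: ler_sum => j _; rewrite RintegralZl//; last first.
      have := integrable_mulr measurableT ((2 ^+ j) ^+ s)^-1 (iscaled j).
      by apply: eq_integrable => // v _ /=; rewrite mulKf// !expf_neq0.
    rewrite -[leLHS](_ : (2 ^+ j) ^+ s * (weight j * trem s.+1 1) = _).
      by rewrite ler_wpM2l ?exprn_ge0// limit_probe_ge.
    by rewrite mulrA weight_scaled mulrAC.
  rewrite -Rintegral_sum//; apply: le_Rintegral => //.
    rewrite (_ : _ \o _ = fun v => \sum_(j < J) (scaled j v)%:E)%E.
      by apply: integrable_sum => // j _; exact: iscaled.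
    by apply/funext => v /=; rewrite sumEFin.
  move=> v _; apply: (@le_trans _ _ (\sum_(j < J) 6 * `|coord v| ^+ s *
      (ramp (2 * (`|coord v| / 2 ^+ j)) - ramp (2 * (`|coord v| / 2 ^+ j.+1))))).
    by apply: ler_sum => j _; exact: scaled_le.
  rewrite -mulr_sumr E12.
  rewrite ler_wpM2l ?mulr_ge0 ?exprn_ge0//.
  pose r j := - ramp (2 * (`|coord v| / 2 ^+ j)).
  rewrite (eq_bigr (fun j : 'I_J => r j.+1 - r j)) => [|j _]; last by rewrite /r opprK addrC.
  rewrite -(big_mkord xpredT (fun j => r j.+1 - r j)) telescope_sumr// /r.
  by have /andP[r1 r2] := ramp01 J v; have /andP[r3 r4] := ramp01 0%N v; lra.
have d0 : 0 < eps * trem s.+1 1 by rewrite mulr_gt0// trem_gt0.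
apply: (@dvg_harmonic R); apply: nondecreasing_is_cvgn.
  apply/nondecreasing_seqP => n; rewrite /series/= big_nat_recr//= lerDl.
  by rewrite /harmonic invr_ge0.
exists (K / (eps * trem s.+1 1)) => _ [n _ <-]; rewrite ler_pdivlMr//.
apply: le_trans (sum_le n); rewrite /series /= big_mkord mulr_suml.
by apply: ler_sum => j _; rewrite mulrC.
Qed.

End sequence.

Lemma axis_moment_space_not_complete :
  (forall b, (mideg b <= s)%N -> 0 <= moment b) /\ ~ seq_complete (moment_space s moment).
Proof.
split=> [b _|complete]; first exact: moment_ge0.
have [u uE] := choice axis_moment_space.
have [l ul] := complete u (axis_sequence_cauchy uE).
by case: (axis_sequence_no_limit uE ul).
Qed.

End axis_measures.

Theorem theorem1p1 (R : realType) (N s : nat) (hN : (1 <= N)%N)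
    (hs : (1 <= s)%N) :
  (~~ odd s ->
     forall M : {ffun 'I_N -> nat} -> R,
       (forall b, (mideg b <= s)%N -> 0 <= M b) ->
       seq_complete (moment_space s M)) /\
  (odd s ->
     exists M : {ffun 'I_N -> nat} -> R,
       (forall b, (mideg b <= s)%N -> 0 <= M b) /\
       ~ seq_complete (moment_space s M)).
Proof.
split=> [s_even M _|s_odd]; first exact: even_seq_complete.
case: N hN => // N' _; have [C [c [C0 c_exact c_le]]] := @interpolation R s./2.
have sE : (s./2).*2.+1 = s by rewrite -[RHS]odd_double_half s_odd.
have [M0 not_complete] := axis_moment_space_not_complete N' C0 c_exact c_le.
by rewrite sE in M0 not_complete; eexists; split; [exact: M0|exact: not_complete].
Qed.
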